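(* Let $a,b$ be indeterminates and $r\in\{1,-1\}$. Let $n$ and $d$ be integers with $d\geq 3$ and $n>1$, such that $\gcd(n,d)=1$ and $n\equiv -r\pmod{d}$. Then for $M=(dn-n-r)/d$ and for $M=n-1$, \[ \sum_{k=0}^{M}[2dk+r]\frac{(aq^r,q^r/a,bq^r,q^r/b,q^r,q^r;q^d)_k}{(aq^d,q^d/a,bq^d,q^d/b,q^d,q^d;q^d)_k}q^{(2d-3r)k} \equiv 0\pmod{[n]\Phi_{n}(q)}. \]
   Context: For an integer $j$, $[j]=[j]_q=(1-q^j)/(1-q)$ denotes the $q$-integer. The $q$-shifted factorial is $(x;q)_0=1$ and $(x;q)_k=(1-x)(1-xq)\cdots(1-xq^{k-1})$ for $k\geq1$, with $(x_1,\dots,x_s;q)_k=(x_1;q)_k\cdots(x_s;q)_k$. $\Phi_n(q)$ is the $n$-th cyclotomic polynomial in $q$. For rational functions $A,B$ in $q$ (with coefficients involving the indeterminates $a,b$) and a polynomial $P(q)$, $A\equiv B\pmod{P(q)}$ means that the numerator of $A-B$ (in reduced form) is divisible by $P(q)$ and its denominator is coprime to $P(q)$. *)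

(* Defs.v *)
From mathcomp Require Export all_boot all_order all_algebra all_field.
From mathcomp Require Export fraction mpoly.

Set Implicit Arguments.
Unset Strict Implicit.
Unset Printing Implicit Defensive.

Import GRing.Theory.
Local Open Scope ring_scope.

Definition qint (K : fieldType) (q : K) (j : int) : K := (1 - q ^ j) / (1 - q).

Definition qpoch (K : fieldType) (x q : K) (k : nat) : K :=
  \prod_(0 <= i < k) (1 - x * q ^+ i).

Definition qpochs (K : fieldType) (xs : seq K) (q : K) (k : nat) : K :=
  \prod_(x <- xs) qpoch x q k.

(* Reduced forms are taken in F(q). For F = Q(a,b) and P with rational
   coefficients this agrees with reduction in Q[a,b][q]: by Gauss's lemma the
   two reduced denominators (and numerators) differ by a factor in F, and every
   irreducible factor of P lies in Q[q]. *)
Definition congr_mod (F : fieldType) (P : {poly F})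
    (A B : {fraction {poly F}}) : Prop :=
  exists u v : {poly F},
    [/\ v != 0, coprimep u v, A - B = tofrac u / tofrac v, P %| u
      & coprimep v P].

Definition qint_poly (F : fieldType) (n : nat) : {poly F} := \sum_(i < n) 'X^i.

Lemma qint_polyE (F : fieldType) (n : nat) :
  tofrac (qint_poly F n) = qint (tofrac 'X) n%:Z.
Proof.
have nz : 1 - tofrac 'X != 0 :> {fraction {poly F}}.
  by rewrite -tofrac1 -tofracB tofrac_eq0 -opprB oppr_eq0 polyXsubC_eq0.
apply: (mulIf nz); rewrite /qint mulfVK // -exprnP -tofracXn -tofrac1 -!tofracB.
rewrite -tofracM; congr tofrac.
by rewrite -[1 - 'X^n]opprB subrX1 mulrC -mulNr opprB.
Qed.

Definition Phi_poly (F : fieldType) (n : nat) : {poly F} :=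
  map_poly (fun z : int => z%:~R) 'Phi_n.

Definition qsum (K : fieldType) (q a b : K) (d : nat) (r : int) (M : nat) : K :=
  \sum_(0 <= k < M.+1)
    qint q (2 * d%:Z * k%:Z + r)
    * (qpochs [:: a * q ^ r; q ^ r / a; b * q ^ r; q ^ r / b; q ^ r; q ^ r]
         (q ^+ d) k
       / qpochs [:: a * q ^+ d; q ^+ d / a; b * q ^+ d; q ^+ d / b;
                   q ^+ d; q ^+ d] (q ^+ d) k)
    * q ^ ((2 * d%:Z - 3 * r) * k%:Z).

Notation Qab := {fraction {mpoly rat[2]}}.

Definition ind_a : Qab := tofrac 'X_(0 : 'I_2).
Definition ind_b : Qab := tofrac 'X_(1 : 'I_2).

Notation Qabq := {fraction {poly Qab}}.

Definition va : Qabq := tofrac ind_a%:P.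
Definition vb : Qabq := tofrac ind_b%:P.
Definition vq : Qabq := tofrac 'X.

(* Main.v *)
(* Put Q = q^d and A = q^r: the sum is a truncated very-well-poised 8phi7 series
   in which A itself occurs once more as a free parameter f. It is estimated at
   each Phi_t with t > 1, t | n.

   Modulo Phi_t, A is Q^-N with 0 <= N < t, and after this substitution the terms
   of index k and N - k are opposite. The series breaks into blocks of length t,
   which modulo Phi_t are multiples of the first one, so it vanishes modulo Phi_t.

   For t = n a second factor Phi_n is needed. Write q^r = Q^-N x with
   x = q^(n(d-1)) = 1 modulo Phi_n, and let A and f vary independently in
   {Q^-N, Q^-N x}. The sums with A = Q^-N vanish identically, whatever f. The sum
   with A = Q^-N x, f = Q^-N terminates, and Watson's transformation shows that it
   is divisible by Phi_n^2. As the mixed second difference of the four sums is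
   divisible by Phi_n^2, so is the sum with A = f = q^r. *)

Require Import Defs.
From mathcomp Require Import ring lra zify.
Import Order.TTheory GRing.Theory Num.Theory.
Local Open Scope ring_scope.

(** * Basic hypergeometric sums *)

(** The argument q^(2d-3r) is forced by well-poisedness: aA, A/a, bA, A/b have product A^4, so the
    argument A^2 Q^2 / (A^4 f) is Q^2 / (A^2 f), that is Q^2 / A^3 at f = A. The factors carrying a
    or b are units at every Phi_t because a and b are not roots of unity, so only the factorials of
    q^r and of Q matter. The obstacle is the second order. With A = f = q^r the series does not
    terminate, and putting Q^-N for q^r costs an error of order one; hence neither the reflection k
    -> N - k nor Watson's formula reaches Phi_n^2 directly. Moving the two occurrences of q^r
    separately leaves three corners with exact evaluations and puts the whole error into a mixed
    difference. That difference needs no formula: being of second order is preserved by sums,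
    products and inverses of units. The size of d matters in the Watson corner, where factorials of
    complementary lengths must supply one Phi_n between them. *)

Section QPoch.
Variables (K : fieldType) (Q : K).
Implicit Types x y : K.

Lemma qpoch0 x : qpoch x Q 0 = 1.
Proof. by rewrite /qpoch big_nil. Qed.

Lemma qpochS x k : qpoch x Q k.+1 = qpoch x Q k * (1 - x * Q ^+ k).
Proof. by rewrite /qpoch big_nat_recr. Qed.

Lemma qpochD x j k : qpoch x Q (j + k) = qpoch x Q j * qpoch (x * Q ^+ j) Q k.
Proof.
elim: k => [|k IH]; first by rewrite addn0 qpoch0 mulr1.
by rewrite addnS !qpochS IH exprD !mulrA.
Qed.

Lemma qpoch_shift x k :
  (1 - x) * qpoch (x * Q) Q k = qpoch x Q k * (1 - x * Q ^+ k).
Proof.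
rewrite -qpochS -add1n qpochD /= expr1; congr (_ * _).
by rewrite qpochS qpoch0 mul1r expr0 mulr1.
Qed.

Lemma qpoch_neq0 x k :
  (forall i, (i < k)%N -> 1 - x * Q ^+ i != 0) -> qpoch x Q k != 0.
Proof.
elim: k => [|k IH] h; first by rewrite qpoch0 oner_eq0.
by rewrite qpochS mulf_neq0 ?h ?IH // => i ik; rewrite h // ltnW.
Qed.

Lemma qpochQ_neq0 y k :
  (forall i, 1 - y * Q ^+ i.+1 != 0) -> qpoch (y * Q) Q k != 0.
Proof. by move=> h; apply: qpoch_neq0 => i _; rewrite -mulrA -exprS h. Qed.

Lemma qpoch_eq0 x k i : (i < k)%N -> x * Q ^+ i = 1 -> qpoch x Q k = 0.
Proof.
move=> ik h; rewrite -(subnKC ik) qpochD qpochS h subrr mulr0 mul0r //.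
Qed.

Lemma qpochs_cons x xs k : qpochs (x :: xs) Q k = qpoch x Q k * qpochs xs Q k.
Proof. by rewrite /qpochs big_cons. Qed.

Lemma qpochs_nil k : qpochs [::] Q k = 1.
Proof. by rewrite /qpochs big_nil. Qed.

Definition qpochsE := (qpochs_cons, qpochs_nil).

Hypothesis Q0 : Q != 0.
Hypothesis hQ : forall i, 1 - Q ^+ i.+1 != 0.

Lemma qpochQQ_neq0 i : qpoch Q Q i != 0.
Proof.
by rewrite -[X in qpoch X]mul1r qpochQ_neq0 // => ?; rewrite mul1r hQ.
Qed.

(** * The terminating 6phi5 sum *)

Section SixPhiFive.
Variables A D E : K.
Hypotheses (A0 : A != 0) (D0 : D != 0) (E0 : E != 0).
Hypothesis hA : forall i, 1 - A * Q ^+ i != 0.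
Hypothesis hD : forall i, 1 - A / D * Q ^+ i.+1 != 0.
Hypothesis hE : forall i, 1 - A / E * Q ^+ i.+1 != 0.

Definition phi65_term p k := (1 - A * Q ^+ (2 * k))
  * (qpoch A Q k * qpoch D Q k * qpoch E Q k * qpoch p Q k)
  / (qpoch Q Q k * qpoch (A / D * Q) Q k * qpoch (A / E * Q) Q k * qpoch (A / p * Q) Q k)
  * (A * Q / (D * E * p)) ^+ k.

(* Telescoping (WZ) certificate for the recurrence in N of the 6phi5 sum, with
   the terminating parameter p = Q^-N kept free. *)
Definition phi65_cert p k := Q ^- k / (1 - p) * (1 - Q ^+ k)
  * (1 - A * Q ^+ k / D) * (1 - A * Q ^+ k / E) * (1 - A * Q ^+ k / p)
  * (qpoch A Q k * qpoch D Q k * qpoch E Q k * qpoch p Q k)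
  / (qpoch Q Q k * qpoch (A / D * Q) Q k * qpoch (A / E * Q) Q k * qpoch (A / p * Q) Q k)
  * (A * Q / (D * E * p)) ^+ k.

Lemma phi65_wz p k : p != 0 -> 1 - p != 0 -> (forall i, 1 - A / p * Q ^+ i != 0) ->
  (1 - A / (D * p)) * (1 - A / (E * p)) * phi65_term p k
  - (1 - A / p) * (1 - A / (D * E * p)) * phi65_term (p * Q) k = phi65_cert p k.+1 - phi65_cert p k.
Proof.
move=> p0 p1 hp.
have hQk := qpochQQ_neq0 k.
have hDk : qpoch (A / D * Q) Q k != 0 by apply: qpochQ_neq0.
have hEk : qpoch (A / E * Q) Q k != 0 by apply: qpochQ_neq0.
have hpk : qpoch (A / p * Q) Q k != 0 by apply: qpochQ_neq0.
have hp'k : qpoch (A / p) Q k != 0 by apply: qpoch_neq0 => i _; apply: hp.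
(* Passing from p to p Q changes (p;Q)_k and (AQ/p;Q)_k by linear factors only, so the claim becomes
   a rational identity in Q^k with the factorials as independent variables. *)
have e1 : qpoch (p * Q) Q k = qpoch p Q k * (1 - p * Q ^+ k) / (1 - p).
  by apply: (canRL (mulfK p1)); rewrite mulrC qpoch_shift.
have e2 : qpoch (A / (p * Q) * Q) Q k = qpoch (A / p * Q) Q k * (1 - A / p) / (1 - A / p * Q ^+ k).
  have -> : A / (p * Q) * Q = A / p by field; rewrite p0 Q0.
  apply: (canRL (mulfK (hp k))).
  by rewrite -qpoch_shift mulrC.
rewrite /phi65_cert /phi65_term !qpochS e1 e2 !exprS mulnC exprM.
have -> : (A * Q / (D * E * (p * Q))) ^+ k = (A * Q / (D * E * p)) ^+ k / Q ^+ k.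
  by rewrite -expr_div_n; congr (_ ^+ _); field; rewrite p0 Q0 D0 E0.
have x0 : Q ^+ k != 0 by rewrite expf_neq0.
move: (hQ k) (hD k) (hE k) (hp 0%N) (hp k) (hp k.+1); rewrite !exprS expr0 mulr1.
move: hQk hDk hEk hpk x0.
move: (qpoch Q Q k) (qpoch (A / D * Q) Q k) (qpoch (A / E * Q) Q k) (qpoch (A / p * Q) Q k) (Q ^+ k).
move: (qpoch A Q k) (qpoch D Q k) (qpoch E Q k) (qpoch p Q k) (_ ^+ k).
move=> a1 a2 a3 a4 z b1 b2 b3 b4 x b10 b20 b30 b40 x0 h1 h2 h3 h4 h5 h6.
have n1 y B : B != 0 -> 1 - A / B * y != 0 -> B - A * y != 0.
  by move=> B0; apply: contraNneq => /subr0_eq h; rewrite mulrAC -h divff // subrr.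
have h2' := n1 _ _ D0 h2; have h3' := n1 _ _ E0 h3.
have h4' : p - A != 0 by rewrite -[A]mulr1 n1 // mulr1.
have h5' : p - A * x != 0 by apply: n1.
have h6' : p - A * (Q * x) != 0 by apply: n1.
by field; do ?[apply/andP; split]; rewrite -?[A * Q * x]mulrA.
Qed.

Lemma sum_6phi5 N :
  \sum_(0 <= k < N.+1) phi65_term (Q ^- N) k
  = (1 - A) * qpoch (A * Q) Q N * qpoch (A / (D * E) * Q) Q N
    / (qpoch (A / D * Q) Q N * qpoch (A / E * Q) Q N).
Proof.
elim: N => [|N IH].
  by rewrite big_nat1 /phi65_term !qpoch0 muln0 !expr0 !mulr1 invr1 !mulr1.
set p := Q ^- N.+1.
have p0 : p != 0 by rewrite invr_neq0 ?expf_neq0.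
have pQ : p * Q = Q ^- N by rewrite /p exprS invfM mulrAC mulVf // mul1r.
have p1 : 1 - p != 0.
  rewrite -(mulfV (expf_neq0 N.+1 Q0)) -/p -[X in _ - X]mul1r -mulrBl.
  by rewrite mulf_neq0 // -opprB oppr_eq0 hQ.
have Ap : A / p = A * Q ^+ N.+1 by rewrite invrK.
have hp i : 1 - A / p * Q ^+ i != 0 by rewrite Ap -mulrA -exprD hA.
(* Both series are summed up to N + 1, one term beyond the end of the one with parameter Q^-N. The
   certificate vanishes at both ends, through 1 - Q^0 and through (p;Q)_(N+2). *)
have t0 : phi65_term (Q ^- N) N.+1 = 0.
  rewrite /phi65_term (@qpoch_eq0 (Q ^- N) N.+1 N) ?mulr0 ?mul0r //.
  by rewrite mulVf ?expf_neq0.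
have G0 : phi65_cert p 0 = 0 by rewrite /phi65_cert expr0 subrr !(mulr0, mul0r).
have G1 : phi65_cert p N.+2 = 0.
  rewrite /phi65_cert (@qpoch_eq0 p N.+2 N.+1) ?(mulr0, mul0r) //.
  by rewrite mulVf ?expf_neq0.
have /eqP : \sum_(0 <= k < N.+2) ((1 - A / (D * p)) * (1 - A / (E * p)) * phi65_term p k
  - (1 - A / p) * (1 - A / (D * E * p)) * phi65_term (p * Q) k) = 0.
  rewrite (eq_bigr (fun k => phi65_cert p k.+1 - phi65_cert p k)) => [|k _]; last exact: phi65_wz.
  by rewrite telescope_sumr // G0 G1 subrr.
rewrite sumrB -!mulr_sumr pQ subr_eq0 => /eqP.
rewrite [in RHS](big_nat_recr N.+1) //= t0 addr0 IH.
have -> : A / (D * p) = A / D * Q * Q ^+ N by rewrite invfM invrK exprS !mulrA.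
have -> : A / (E * p) = A / E * Q * Q ^+ N by rewrite invfM invrK exprS !mulrA.
have -> : A / (D * E * p) = A / (D * E) * Q * Q ^+ N.
  by rewrite [(_ * p)^-1]invfM invrK exprS !mulrA.
rewrite Ap exprS mulrA !qpochS.
have := hD N; have := hE N; rewrite exprS mulrA => h1; rewrite mulrA => h2.
have h3 := qpochQ_neq0 _ N hD; have h4 := qpochQ_neq0 _ N hE.
move=> h; apply: (mulfI (mulf_neq0 h2 h1)); rewrite {}h.
move: h1 h2 h3 h4; move: (A / E * Q) (A / D * Q) => u v h1 h2 h3 h4.
by field; do ?[apply/andP; split].
Qed.
End SixPhiFive.

(** * The q-Pfaff-Saalschuetz sum *)

Section BaileyPair.
Variables A B C : K.
Hypotheses (A0 : A != 0) (B0 : B != 0) (C0 : C != 0).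
Hypothesis hA : forall i, 1 - A * Q ^+ i != 0.
Hypothesis hB : forall i, 1 - A / B * Q ^+ i.+1 != 0.
Hypothesis hC : forall i, 1 - A / C * Q ^+ i.+1 != 0.

(* The summand of the q-Pfaff-Saalschuetz sum, with (Q^-k;Q)_j / (Q;Q)_k
   rewritten through (Q;Q)_(k-j) so as to be defined for j <= k only. *)
Definition bailey_term k j := (-1) ^+ j * Q ^+ ('C(j, 2) + j) / Q ^+ (j * k)
  * qpoch A Q (j + k) * qpoch (A / (B * C) * Q) Q j
  / (qpoch Q Q (k - j) * qpoch Q Q j * qpoch (A / B * Q) Q j * qpoch (A / C * Q) Q j).

(** Telescoping certificate in j for a first-order recurrence in k, which the product in
    [sum_bailey_term] also satisfies. *)
Definition bailey_cert k j :=
  - Q ^+ k.+1 / Q ^+ j * (1 - A * Q ^+ (2 * k).+1) / (1 - A * Q ^+ (j + k))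
  * (1 - Q ^+ j) * (1 - A / B * Q ^+ j) * (1 - A / C * Q ^+ j) * bailey_term k.+1 j.

Lemma bailey_wz k j : (j <= k)%N ->
  (1 - Q ^+ k.+1) * (1 - A / B * Q ^+ k.+1) * (1 - A / C * Q ^+ k.+1) * bailey_term k.+1 j
  - A / (B * C) * Q * (1 - A * Q ^+ k) * (1 - B * Q ^+ k) * (1 - C * Q ^+ k) * bailey_term k j
  = bailey_cert k j.+1 - bailey_cert k j.
Proof.
move=> jk.
have hBj : qpoch (A / B * Q) Q j != 0 by apply: qpochQ_neq0.
have hCj : qpoch (A / C * Q) Q j != 0 by apply: qpochQ_neq0.
rewrite /bailey_cert /bailey_term !addnS !addSn.
have -> : (k.+1 - j = (k - j).+1)%N by lia.
have -> : (k.+1 - j.+1 = k - j)%N by lia.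
rewrite !qpochS binS bin1 !mulSn !mulnS mul0n addn0 [(j * k)%N]mulnC !(exprS, exprD).
have -> : Q ^+ k = Q ^+ j * Q ^+ (k - j) by rewrite -exprD subnKC.
have x0 : Q ^+ j != 0 by rewrite expf_neq0.
have y0 : Q ^+ (k - j) != 0 by rewrite expf_neq0.
have w0 : Q ^+ (k * j) != 0 by rewrite expf_neq0.
move: (hQ j) (hQ (k - j)) (hA (j + k)%N) (hA (j + k).+1) (hB j) (hC j)
  (qpochQQ_neq0 (k - j)%N) (qpochQQ_neq0 j) hBj hCj.
rewrite !exprS exprD.
have -> : Q ^+ k = Q ^+ j * Q ^+ (k - j) by rewrite -exprD subnKC.
move: (Q ^+ j) (Q ^+ (k - j)) (Q ^+ (k * j)) x0 y0 w0 => x y w x0 y0 w0.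
move: (qpoch _ _ _) (qpoch _ _ _) (qpoch _ _ _) (qpoch _ _ _) (qpoch _ _ _) (qpoch _ _ _).
move=> a1 a2 a3 a4 a5 a6; move: ((-1) ^+ j) (Q ^+ 'C(j, 2)) => s c.
move=> h1 h2 h3 h4 h5 h6 h7 h8 h9 h10.
have n1 y1 D : D != 0 -> 1 - A / D * y1 != 0 -> D - A * y1 != 0.
  by move=> D0; apply: contraNneq => /subr0_eq h; rewrite mulrAC -h divff // subrr.
have h5' := n1 _ _ B0 h5; have h6' := n1 _ _ C0 h6.
by field; do ?[apply/andP; split]; rewrite -?[A * Q * x]mulrA.
Qed.

Lemma sum_bailey_term k : \sum_(0 <= j < k.+1) bailey_term k j
  = (A / (B * C) * Q) ^+ k * (qpoch A Q k * qpoch B Q k * qpoch C Q k)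
    / (qpoch Q Q k * qpoch (A / B * Q) Q k * qpoch (A / C * Q) Q k).
Proof.
elim: k => [|k IH].
  by rewrite big_nat1 /bailey_term !qpoch0 !expr0 !mulr1 !divr1.
have h1 := hQ k; have h2 := hB k; have h3 := hC k; have h4 := qpochQQ_neq0 k.
have h5 := qpochQ_neq0 _ k hB; have h6 := qpochQ_neq0 _ k hC.
have H0 : bailey_cert k 0 = 0 by rewrite /bailey_cert expr0 subrr !(mulr0, mul0r).
(* Truncated subtraction keeps [bailey_term k k.+1] from being 0, so the recurrence is summed over j
   <= k only. The boundary value of the certificate supplies the missing summand j = k + 1 of the
   sum for k + 1. *)
have H1 : bailey_cert k k.+1 = - ((1 - Q ^+ k.+1) * (1 - A / B * Q ^+ k.+1)
    * (1 - A / C * Q ^+ k.+1) * bailey_term k.+1 k.+1).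
  by rewrite /bailey_cert !mulNr divff ?expf_neq0 // mul1r mul2n -addnn addSn divff ?hA // mul1r.
have : \sum_(0 <= j < k.+1)
    ((1 - Q ^+ k.+1) * (1 - A / B * Q ^+ k.+1) * (1 - A / C * Q ^+ k.+1)
       * bailey_term k.+1 j
     - A / (B * C) * Q * (1 - A * Q ^+ k) * (1 - B * Q ^+ k) * (1 - C * Q ^+ k)
       * bailey_term k j) = bailey_cert k k.+1.
  rewrite big_nat_cond (eq_bigr (fun k0 => bailey_cert k k0.+1 - bailey_cert k k0)) => [|j].
    by rewrite -big_nat_cond telescope_sumr // H0 subr0.
  by rewrite andbT /= ltnS => jk; rewrite bailey_wz.
rewrite sumrB -!mulr_sumr IH H1 => /eqP.
rewrite subr_eq [X in _ == X]addrC -subr_eq opprK -mulrDr -big_nat_recr //= => /eqP h.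
apply: (mulfI (mulf_neq0 (mulf_neq0 h1 h2) h3)); rewrite {}h.
rewrite !qpochS !exprS in h1 h2 h3 *; rewrite !mulrA in h2 h3 *.
move: h1 h2 h3 h4 h5 h6; move: (A / B * Q) (A / C * Q) => u v h1 h2 h3 h4 h5 h6.
by field; do ?[apply/andP; split].
Qed.

End BaileyPair.

Lemma exchange_triangle N (f : nat -> nat -> K) :
  \sum_(0 <= k < N.+1) \sum_(0 <= j < k.+1) f k j
  = \sum_(0 <= j < N.+1) \sum_(0 <= i < (N - j).+1) f (j + i)%N j.
Proof.
elim: N => [|N IH]; first by rewrite !big_nat1.
rewrite big_nat_recr //= IH [RHS]big_nat_recr //= subnn [X in _ = _ + X]big_nat1 addn0.
rewrite [X in _ + X = _]big_nat_recr //= addrA; congr (_ + _).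
rewrite -big_split /=; apply: eq_big_nat => j /andP[_]; rewrite ltnS => jN.
by rewrite subSn // [RHS]big_nat_recr //= -subSn // subnKC // leqW.
Qed.

(* Watson's 8phi7 transformation. The prefactor is distributed over the
   summands of the 4phi3 so that the factors divisible by Phi_n are visible in
   each of them; it follows by expanding the B, C part with sum_bailey_term and
   summing over the other index with sum_6phi5. *)
Lemma watson A B C D E N :
  A != 0 -> B != 0 -> C != 0 -> D != 0 -> E != 0 ->
  (forall i, 1 - A * Q ^+ i != 0) ->
  (forall i, 1 - A / B * Q ^+ i.+1 != 0) ->
  (forall i, 1 - A / C * Q ^+ i.+1 != 0) ->
  (forall i, 1 - A / D * Q ^+ i.+1 != 0) ->
  (forall i, 1 - A / E * Q ^+ i.+1 != 0) ->
  let p := Q ^- N in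
  \sum_(0 <= k < N.+1) (1 - A * Q ^+ (2 * k)) *
    (qpoch A Q k * qpoch B Q k * qpoch C Q k * qpoch D Q k * qpoch E Q k * qpoch p Q k) /
    (qpoch Q Q k * qpoch (A / B * Q) Q k * qpoch (A / C * Q) Q k
     * qpoch (A / D * Q) Q k * qpoch (A / E * Q) Q k * qpoch (A / p * Q) Q k)
    * (A ^+ 2 * Q ^+ 2 / (B * C * D * E * p)) ^+ k
  = \sum_(0 <= j < N.+1)
     qpoch A Q (j + N).+1 * (qpoch (A / (B * C) * Q) Q j * qpoch (A / (D * E) * Q) Q (N - j)) *
     ((- 1) ^+ j / Q ^+ 'C(j, 2) * (A / (D * E * p) * Q) ^+ j *
      (qpoch D Q j * qpoch E Q j * qpoch p Q j) /
      (qpoch Q Q j * qpoch (A / B * Q) Q j * qpoch (A / C * Q) Q j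
       * qpoch (A / p * Q) Q j * qpoch (A / D * Q) Q N * qpoch (A / E * Q) Q N)).
Proof.
move=> A0 B0 C0 D0 E0 hA hB hC hD hE p.
have p0 : p != 0 by rewrite invr_neq0 ?expf_neq0.
pose w k := (1 - A * Q ^+ (2 * k)) * (qpoch D Q k * qpoch E Q k * qpoch p Q k)
  / (qpoch (A / D * Q) Q k * qpoch (A / E * Q) Q k * qpoch (A / p * Q) Q k)
  * (A / (D * E * p) * Q) ^+ k.
transitivity (\sum_(0 <= k < N.+1) \sum_(0 <= j < k.+1) w k * bailey_term A B C k j).
  apply: eq_bigr => k _; rewrite -mulr_sumr sum_bailey_term // /w.
  have -> : A ^+ 2 * Q ^+ 2 / (B * C * D * E * p) = (A / (D * E * p) * Q) * (A / (B * C) * Q).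
    by field; rewrite p0 E0 D0 C0 B0.
  by rewrite exprMn !invfM; ring.
rewrite exchange_triangle; apply: eq_big_nat => j /andP[_]; rewrite ltnS => jN.
have x0 i : Q ^+ i != 0 by rewrite expf_neq0.
(* After the shift k = j + i the inner sum is a 6phi5 with A Q^(2j), D Q^j, E Q^j and p Q^j =
   Q^-(N-j): A/D and A/E are multiplied by Q^j, while A/(DE) is unchanged. *)
pose A' := A * Q ^+ (2 * j); pose D' := D * Q ^+ j; pose E' := E * Q ^+ j.
have pj : p * Q ^+ j = Q ^- (N - j).
  by rewrite /p -{1}(subnK jN) exprD invfM -mulrA mulVf // mulr1.
have AD : A' / D' * Q = A / D * Q * Q ^+ j.
  by rewrite /A' /D' mul2n -addnn exprD; field; rewrite ?x0 ?D0 ?E0 ?p0.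
have AE : A' / E' * Q = A / E * Q * Q ^+ j.
  by rewrite /A' /E' mul2n -addnn exprD; field; rewrite ?x0 ?D0 ?E0 ?p0.
have ADE : A' / (D' * E') = A / (D * E).
  by rewrite /A' /D' /E' mul2n -addnn exprD; field; rewrite ?x0 ?D0 ?E0 ?p0.
have Ap : A' / (p * Q ^+ j) * Q = A / p * Q * Q ^+ j.
  by rewrite /A' mul2n -addnn exprD; field; rewrite ?x0 ?D0 ?E0 ?p0.
transitivity (\sum_(0 <= i < (N - j).+1)
   (qpoch A Q (j + j) * qpoch (A / (B * C) * Q) Q j *
     ((- 1) ^+ j / Q ^+ 'C(j, 2) * (A / (D * E * p) * Q) ^+ j *
      (qpoch D Q j * qpoch E Q j * qpoch p Q j) /
      (qpoch Q Q j * qpoch (A / B * Q) Q j * qpoch (A / C * Q) Q j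
       * qpoch (A / p * Q) Q j * qpoch (A / D * Q) Q j * qpoch (A / E * Q) Q j)))
     * phi65_term A' D' E' (Q ^- (N - j)) i).
  apply: eq_bigr => i _; rewrite -pj /w /bailey_term /phi65_term AD AE Ap.
  rewrite addKn (addnA j j i) !qpochD /A' /D' /E' !mul2n -!addnn.
  set Z := A / (D * E * p) * Q.
  have -> : A * Q ^+ (j + j) * Q / (D * Q ^+ j * (E * Q ^+ j) * (p * Q ^+ j)) = Z / Q ^+ j.
    by rewrite /Z exprD; field; rewrite ?x0 ?D0 ?E0 ?p0.
  have pw : Z ^+ (j + i) * ((-1) ^+ j * Q ^+ ('C(j, 2) + j) / Q ^+ (j * (j + i)))
      = (-1) ^+ j / Q ^+ 'C(j, 2) * Z ^+ j * (Z / Q ^+ j) ^+ i.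
    have -> : (j * (j + i) = 'C(j, 2) + 'C(j, 2) + j + j * i)%N.
      rewrite mulnDr; congr (_ + _)%N; elim: (j) => [//|m IHm].
      by rewrite binS bin1; nia.
    rewrite expr_div_n -exprM !exprD; move: (x0 'C(j, 2)) (x0 j) (x0 (j * i)%N).
    move: (Q ^+ 'C(j, 2)) (Q ^+ j) (Q ^+ (j * i)) => c x y c0 xj y0.
    by field; rewrite c0 xj y0.
  rewrite [LHS](_ : _ = Z ^+ (j + i) * ((-1) ^+ j * Q ^+ ('C(j, 2) + j) / Q ^+ (j * (j + i))) *
    ((1 - A * Q ^+ (j + i + (j + i))) *
  (qpoch D Q j * qpoch (D * Q ^+ j) Q i * (qpoch E Q j * qpoch (E * Q ^+ j) Q i) *
   (qpoch p Q j * qpoch (p * Q ^+ j) Q i)) /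
  (qpoch (A / D * Q) Q j * qpoch (A / D * Q * Q ^+ j) Q i *
   (qpoch (A / E * Q) Q j * qpoch (A / E * Q * Q ^+ j) Q i) *
   (qpoch (A / p * Q) Q j * qpoch (A / p * Q * Q ^+ j) Q i)) *
  ((qpoch A Q j * qpoch (A * Q ^+ j) Q j * qpoch (A * Q ^+ (j + j)) Q i) *
   qpoch (A / (B * C) * Q) Q j /
   (qpoch Q Q i * qpoch Q Q j * qpoch (A / B * Q) Q j * qpoch (A / C * Q) Q j)))); last by ring.
  rewrite pw -[A * Q ^+ (j + j) * _]mulrA -exprD.
  have -> : (j + j + (i + i) = j + i + (j + i))%N by lia.
  by rewrite !invfM; ring.
rewrite -mulr_sumr sum_6phi5 ?mulf_neq0 //; last 3 first.
- by move=> i; rewrite /A' -mulrA -exprD hA.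
- by move=> i; rewrite exprS mulrA AD -mulrA -exprD -mulrA -exprS hD.
- by move=> i; rewrite exprS mulrA AE -mulrA -exprD -mulrA -exprS hE.
rewrite AD AE ADE qpoch_shift -qpochS -/A'.
have -> : ((j + N).+1 = j + j + (N - j).+1)%N by lia.
have split_qpoch y : qpoch y Q N = qpoch y Q j * qpoch (y * Q ^+ j) Q (N - j).
  by rewrite -qpochD subnKC.
rewrite (split_qpoch (A / D * Q)) (split_qpoch (A / E * Q)) !qpochD /A' mul2n -addnn.
by rewrite !invfM; ring.
Qed.

(* Well-poised means h = A, r = Q and f * s = A * Q. The parameters are kept
   independent because replacing k by L + k multiplies A, f, r, s by Q^L but h
   by Q^(2L). *)
Definition vwp a b h A f r s z k :=
  (1 - h * Q ^+ (2 * k)) *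
  (qpochs [:: a * A; A / a; b * A; A / b; A; f] Q k
   / qpochs [:: a * r; r / a; b * r; r / b; r; s] Q k) * z ^+ k.

(** Reading the factors backwards turns a factorial starting at x Q^-N into one starting inside that
    of Q/x. Writing N = k + m avoids the subtraction N - k. *)
Lemma qpoch_reflect x k m : x != 0 ->
  qpoch (x * Q ^- (k + m)) Q k * qpoch (x^-1 * Q) Q m
  = (- x) ^+ k * Q ^+ 'C(k, 2) / Q ^+ (k * (k + m)) * qpoch (x^-1 * Q) Q (k + m).
Proof.
move=> x0; elim: k m => [|k IH] m; first by rewrite qpoch0 !expr0 invr1 !mul1r.
rewrite qpochS addSnnS mulrAC -mulrA.
have -> : qpoch (x^-1 * Q) Q m * (1 - x * Q ^- (k + m.+1) * Q ^+ k)
   = - x / Q ^+ m.+1 * qpoch (x^-1 * Q) Q m.+1.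
  rewrite qpochS exprD exprS; have := expf_neq0 k Q0; have := expf_neq0 m Q0.
  by move: (Q ^+ k) (Q ^+ m) => y w w0 y0; field; rewrite x0 y0 Q0 w0.
rewrite mulrCA IH mulrA; congr (_ * _).
rewrite binS bin1 mulSn !exprD !exprS; have := expf_neq0 k Q0; have := expf_neq0 m Q0.
have := expf_neq0 (k * (k + m.+1)) Q0.
move: (Q ^+ k) (Q ^+ m) (Q ^+ (k * (k + m.+1))) => y w v v0 w0 y0.
by field; rewrite v0 y0 Q0 w0.
Qed.

(** * Antisymmetry of the terminating series *)

Section Pairing.
Variables a b c : K.
Hypotheses (a0 : a != 0) (b0 : b != 0) (c0 : c != 0).
Hypotheses (ha : forall i, 1 - a * Q ^+ i.+1 != 0)
  (ha' : forall i, 1 - a^-1 * Q ^+ i.+1 != 0)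
  (hb : forall i, 1 - b * Q ^+ i.+1 != 0)
  (hb' : forall i, 1 - b^-1 * Q ^+ i.+1 != 0)
  (hc : forall i, 1 - c^-1 * Q ^+ i.+1 != 0).

Let ys := [:: a * Q; Q / a; b * Q; Q / b; Q; Q / c].

(** The right side is symmetric in k and m except for Q^m - Q^k, so exchanging k with N - k changes
    the sign. This works because reversing the six numerator factorials at A = Q^-N produces exactly
    the six denominator parameters [ys]. *)
Lemma vwp_pair k m :
  vwp a b (Q ^- (k + m)) (Q ^- (k + m)) (c / Q ^+ (k + m)) Q (Q / c) (Q ^+ (3 * (k + m) + 2) / c) k
  = (Q ^+ m - Q ^+ k) / (Q ^+ (m + k) * Q ^+ (3 * (k * m))) *
    (qpochs ys Q (k + m) / (qpochs ys Q k * qpochs ys Q m)).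
Proof.
rewrite /vwp /ys !qpochsE !mulr1 ![Q / _]mulrC ![_ ^-_ / _]mulrC.
have R x : x != 0 -> (forall i, 1 - x^-1 * Q ^+ i.+1 != 0) ->
  qpoch (x * Q ^- (k + m)) Q k =
  (- x) ^+ k * (Q ^+ 'C(k, 2) / Q ^+ (k * (k + m))) * qpoch (x^-1 * Q) Q (k + m) / qpoch (x^-1 * Q) Q m.
  move=> x0 hx; rewrite [in RHS]mulrA -qpoch_reflect // mulfK //.
  exact: qpochQ_neq0.
have R1 : qpoch (Q ^- (k + m)) Q k =
  (- 1) ^+ k * (Q ^+ 'C(k, 2) / Q ^+ (k * (k + m))) * qpoch Q Q (k + m) / qpoch Q Q m.
  rewrite -[Q ^- _]mul1r R ?oner_neq0 ?invr1 ?mul1r // => i.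
  by rewrite mul1r hQ.
rewrite !R ?invr_eq0 ?invrK ?R1 //.
have neg1 x : x != 0 -> (- x) ^+ k * (- x^-1) ^+ k = 1.
  by move=> x0; rewrite -exprMn mulrNN divff // expr1n.
(* The signs and powers left by the six reversals: those of a, 1/a and of b, 1/b cancel in pairs,
   and z^k turns the rest into a symmetric power of Q. Quadratic exponents are reduced by k^2 = 2
   C(k,2) + k. *)
have pw : ((- 1) ^+ k * (- c) ^+ k) * ((Q ^+ 'C(k, 2) / Q ^+ (k * (k + m))) ^+ 6
    * (1 - Q ^- (k + m) * Q ^+ (2 * k)) * (Q ^+ (3 * (k + m) + 2) / c) ^+ k)
   = (Q ^+ m - Q ^+ k) / (Q ^+ (m + k) * Q ^+ (3 * (k * m))).
  rewrite -exprMn mulN1r opprK !expr_div_n -!exprM ![(_ * 6)%N]mulnC.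
  have -> : (k * (k + m) = 'C(k, 2) + 'C(k, 2) + k + k * m)%N.
    rewrite mulnDr; congr (_ + _)%N; elim: (k) => [//|l IHl].
    by rewrite binS bin1; nia.
  have -> : ((3 * (k + m) + 2) * k = 3 * (('C(k, 2) + 'C(k, 2) + k) + k * m) + 2 * k)%N.
    have : (k * k = 'C(k, 2) + 'C(k, 2) + k)%N.
      by elim: (k) => [//|l IHl]; rewrite binS bin1; nia.
    by nia.
  rewrite !mulSn !mul0n !addn0 !exprD.
  have := expf_neq0 'C(k, 2) Q0; have := expf_neq0 k Q0; have := expf_neq0 m Q0.
  have := expf_neq0 (k * m) Q0; have := expf_neq0 k c0.
  move: (c ^+ k) (Q ^+ (k * m)) (Q ^+ m) (Q ^+ k) (Q ^+ 'C(k, 2)).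
  by move=> v w y x u v0 w0 y0 x0 u0; field; rewrite v0 w0 y0 x0 u0.
rewrite -pw.
have nn X : X = ((- a) ^+ k * (- a^-1) ^+ k) * ((- b) ^+ k * (- b^-1) ^+ k) * X.
  by rewrite !neg1 // !mul1r.
rewrite [RHS]nn {pw nn}.
move: ((- a) ^+ k) ((- a^-1) ^+ k) ((- b) ^+ k) ((- b^-1) ^+ k) => x1 x2 x3 x4.
move: ((- 1) ^+ k) ((- c) ^+ k) => x5 x6.
by rewrite !invfM; ring.
Qed.

Lemma sum_vwp0 N : 1 + 1 != 0 :> K ->
  \sum_(0 <= k < N.+1)
    vwp a b (Q ^- N) (Q ^- N) (c / Q ^+ N) Q (Q / c) (Q ^+ (3 * N + 2) / c) k = 0.
Proof.
move=> two; set f := vwp _ _ _ _ _ _ _ _.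
suff : \sum_(0 <= k < N.+1) f k = - \sum_(0 <= k < N.+1) f k.
  move/eqP; rewrite -addr_eq0; set S := \sum_(_ <= _ < _) _.
  by rewrite -[S]mul1r -mulrDl mulf_eq0 (negbTE two) mul1r => /eqP.
rewrite {1}big_nat_rev /= -sumrN; apply: eq_big_nat => k /andP[_].
rewrite ltnS add0n subSS => kN.
have fE i j : (i + j = N)%N -> f i = (Q ^+ j - Q ^+ i) / (Q ^+ (j + i) * Q ^+ (3 * (i * j))) *
    (qpochs ys Q N / (qpochs ys Q i * qpochs ys Q j)).
  by move=> e; rewrite /f -e vwp_pair.
rewrite (fE (N - k)%N k) ?subnK // (fE k (N - k)%N) ?subnKC //.
rewrite -!mulNr opprB [((N - k) * k)%N]mulnC [(N - k + k)%N]addnC.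
by rewrite [qpochs _ _ k * _]mulrC subnKC.
Qed.
End Pairing.
End QPoch.

(** * Filtrations and second differences *)

Section LocalRing.
Variables (F : fieldType) (P : {poly F}).
Hypothesis P1 : (1 < size P)%N.
Local Notation K := {fraction {poly F}}.

Definition padic_ge e (x : K) :=
  exists u v, coprimep v P /\ x = tofrac (P ^+ e * u) / tofrac v.

Definition padic_unit (x : K) :=
  exists u v, [/\ coprimep u P, coprimep v P & x = tofrac u / tofrac v].

Lemma coprimep_neq0 v : coprimep v P -> tofrac v != 0 :> K.
Proof.
rewrite tofrac_eq0; apply: contraTneq => ->.
by rewrite coprime0p -size_poly_eq1 gtn_eqF.
Qed.

Lemma padic_geD e x y : padic_ge e x -> padic_ge e y -> padic_ge e (x + y).
Proof.
move=> [u [v [cv ->]]] [u' [v' [cv' ->]]].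
exists (u * v' + u' * v), (v * v'); split; first by rewrite coprimepMl cv.
rewrite addf_div ?coprimep_neq0 // -!tofracM -tofracD.
by rewrite mulrDr !mulrA.
Qed.

Lemma padic_geM e f x y : padic_ge e x -> padic_ge f y -> padic_ge (e + f) (x * y).
Proof.
move=> [u [v [cv ->]]] [u' [v' [cv' ->]]].
exists (u * u'), (v * v'); split; first by rewrite coprimepMl cv.
by rewrite mulf_div -!tofracM exprD mulrACA.
Qed.

Lemma padic_unit_poly p : coprimep p P -> padic_unit (tofrac p).
Proof. by move=> cp; exists p, 1; rewrite coprime1p tofrac1 divr1. Qed.

Lemma padic_ge_poly p : padic_ge 0 (tofrac p).
Proof. by exists p, 1; rewrite coprime1p tofrac1 divr1 expr0 mul1r. Qed.

Lemma padic_ge1_poly p : P %| p -> padic_ge 1 (tofrac p).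
Proof.
move=> /dvdpP[q ->]; exists q, 1.
by rewrite coprime1p tofrac1 divr1 expr1 mulrC.
Qed.

Lemma padic_unit_ge0 x : padic_unit x -> padic_ge 0 x.
Proof. by move=> [u [v [_ cv ->]]]; exists u, v; rewrite expr0 mul1r. Qed.

Lemma padic_unit_neq0 x : padic_unit x -> x != 0.
Proof.
move=> [u [v [cu cv ->]]].
by rewrite mulf_neq0 ?invr_neq0 //; apply: coprimep_neq0.
Qed.

Lemma padic_unit1 : padic_unit 1.
Proof. by rewrite -tofrac1; apply: padic_unit_poly; apply: coprime1p. Qed.

Lemma padic_unitM x y : padic_unit x -> padic_unit y -> padic_unit (x * y).
Proof.
move=> [u [v [cu cv ->]]] [u' [v' [cu' cv' ->]]].
exists (u * u'), (v * v'); rewrite !coprimepMl cu cv; split=> //.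
by rewrite mulf_div -!tofracM.
Qed.

Lemma padic_unitV x : padic_unit x -> padic_unit x^-1.
Proof.
by move=> [u [v [cu cv ->]]]; exists v, u; rewrite invfM invrK mulrC.
Qed.

Lemma padic_unitX x n : padic_unit x -> padic_unit (x ^+ n).
Proof.
move=> ux; elim: n => [|n IH]; first exact: padic_unit1.
by rewrite exprS; apply: padic_unitM.
Qed.

Lemma padic_ge0 e : padic_ge e 0.
Proof. by exists 0, 1; rewrite coprime1p mulr0 tofrac0 mul0r. Qed.

Lemma padic_geS e x : padic_ge e.+1 x -> padic_ge e x.
Proof.
move=> [u [v [cv ->]]]; exists (P * u), v; split=> //.
by rewrite exprSr mulrA.
Qed.

Lemma padic_geMl e x y : padic_ge 0 x -> padic_ge e y -> padic_ge e (x * y).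
Proof. exact: padic_geM. Qed.

Lemma padic_geN e x : padic_ge e x -> padic_ge e (- x).
Proof.
move=> [u [v [cv ->]]]; exists (- u), v; split=> //.
by rewrite mulrN tofracN mulNr.
Qed.

Lemma padic_geB e x y : padic_ge e x -> padic_ge e y -> padic_ge e (x - y).
Proof. by move=> hx hy; apply/padic_geD/padic_geN. Qed.

Lemma padic_ge_sum e (I : Type) (r : seq I) (p : pred I) (f : I -> K) :
  (forall i, p i -> padic_ge e (f i)) -> padic_ge e (\sum_(i <- r | p i) f i).
Proof.
by move=> h; apply: big_ind => //; [apply: padic_ge0 | apply: padic_geD].
Qed.

Lemma padic_unit_addr x y : padic_unit x -> padic_ge 1 y -> padic_unit (x + y).
Proof.
move=> [u [v [cu cv ->]]] [u' [v' [cv' ->]]].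
exists (u * v' + P * (u' * v)), (v * v'); split.
- by rewrite coprimep_sym addrC mulrC coprimep_addl_mul coprimep_sym coprimepMl cu.
- by rewrite coprimepMl cv.
- by rewrite addf_div ?coprimep_neq0 // -!tofracM -tofracD expr1 mulrA.
Qed.

Lemma padic_unit_factor x y : padic_ge 0 x -> padic_ge 0 y -> padic_unit (x * y) -> padic_unit x.
Proof.
move=> [u [v [cv ->]]] [u' [v' [cv' ->]]] [w [w' [cw cw' e]]].
rewrite !expr0 !mul1r in e *; exists u, v; split=> //.
move/eqP: e; rewrite mulf_div eqr_div ?mulf_neq0 ?coprimep_neq0 //.
rewrite -!tofracM tofrac_eq => /eqP e.
have : coprimep (u * u' * w') P by rewrite e !coprimepMl cw cv.
by rewrite !coprimepMl => /andP[/andP[]].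
Qed.

End LocalRing.

(* The q-series are estimated over an abstract field K: in {fraction {poly F}}
   itself, conversion tends to unfold the quotient. *)
Record filtration (K : fieldType) := Filtration {
  val_ge : nat -> K -> Prop;
  val_unit : K -> Prop;
  val_ge0 : forall e, val_ge e 0;
  val_geD : forall e x y, val_ge e x -> val_ge e y -> val_ge e (x + y);
  val_geN : forall e x, val_ge e x -> val_ge e (- x);
  val_geM : forall e f x y, val_ge e x -> val_ge f y -> val_ge (e + f) (x * y);
  val_geS : forall e x, val_ge e.+1 x -> val_ge e x;
  val_unit1 : val_unit 1;
  val_unitM : forall x y, val_unit x -> val_unit y -> val_unit (x * y);
  val_unitV : forall x, val_unit x -> val_unit x^-1;
  val_unit_ge0 : forall x, val_unit x -> val_ge 0 x;
  val_unit_neq0 : forall x, val_unit x -> x != 0;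
  val_unit_addr : forall x y, val_unit x -> val_ge 1 y -> val_unit (x + y) }.

Section Filtration.
Variables (K : fieldType) (V : filtration K).
Local Notation dv := (val_ge K V).
Local Notation un := (val_unit K V).

Lemma val_geMl e x y : dv 0 x -> dv e y -> dv e (x * y).
Proof. exact: val_geM. Qed.

Lemma val_geMr e x y : dv e x -> dv 0 y -> dv e (x * y).
Proof. by move=> hx hy; rewrite mulrC; apply: val_geMl. Qed.

Lemma val_geB e x y : dv e x -> dv e y -> dv e (x - y).
Proof. by move=> hx hy; apply/val_geD/val_geN. Qed.

Lemma val_ge_sum e (I : Type) (r : seq I) (p : pred I) (f : I -> K) :
  (forall i, p i -> dv e (f i)) -> dv e (\sum_(i <- r | p i) f i).
Proof.
by move=> h; apply: big_ind => //; [apply: val_ge0 | apply: val_geD].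
Qed.

Lemma val_geX x n : dv 0 x -> dv 0 (x ^+ n).
Proof.
move=> ux; elim: n => [|n IH]; first by apply/val_unit_ge0/val_unit1.
by rewrite exprS; apply: val_geMl.
Qed.

Lemma val_unitXz x (s : int) : un x -> un (x ^ s).
Proof.
have vuX n : un x -> un (x ^+ n).
  move=> ux; elim: n => [|n IH]; first exact: val_unit1.
  by rewrite exprS; apply: val_unitM.
by case: s => n ux; [apply: vuX | apply/val_unitV/vuX].
Qed.

(* Quadruples that look like f(x, y) for x, y in {0, e}, e a uniformizer, with f
   smooth: corners agree to first order, the mixed difference to second order. *)
Definition grid (f : bool -> bool -> K) :=
  [/\ dv 0 (f false false), dv 1 (f true false - f false false),
      dv 1 (f false true - f false false)
    & dv 2 (f true true - f true false - f false true + f false false)].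

Lemma grid_cst x : dv 0 x -> grid (fun _ _ => x).
Proof. by split; rewrite // ?subrr ?sub0r ?addNr; try apply: val_ge0. Qed.

(** A discrete Leibniz rule: each summand on the right contains a mixed difference or one first
    difference in each direction, hence is of second order. *)
Lemma second_difference_mul (L : comRingType) (f f10 f01 f11 g g10 g01 g11 : L) :
  f11 * g11 - f10 * g10 - f01 * g01 + f * g =
  (f11 - f10 - f01 + f) * g11 + (f10 - f) * (g11 - g10 - g01 + g) + (f10 - f) * (g01 - g)
  + (f01 - f) * (g11 - g10 - g01 + g) + (f01 - f) * (g10 - g) + f * (g11 - g10 - g01 + g).
Proof. by ring. Qed.

Lemma second_difference_inv (L : fieldType) (f f10 f01 f11 : L) :
  f != 0 -> f10 != 0 -> f01 != 0 -> f11 != 0 ->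
  f11^-1 - f10^-1 - f01^-1 + f^-1 =
  ((f01 - f) * (f11 * (f10 - f) + f * (f11 - f01))
   - (f11 - f10 - f01 + f) * (f01 * f)) * (f11^-1 * f10^-1 * (f01^-1 * f^-1)).
Proof. by move=> h1 h2 h3 h4; field; rewrite h1 h2 h3 h4. Qed.

Lemma val_ge_sub x y : dv 0 x -> dv 1 (y - x) -> dv 0 y.
Proof. by move=> hx hy; rewrite -[y](subrK x) addrC; apply/val_geD/val_geS. Qed.

Lemma diagonal_difference (L : comRingType) (f f10 f01 f11 : L) :
  f11 - f = (f11 - f10 - f01 + f) + (f10 - f) + (f01 - f).
Proof. by ring. Qed.

Lemma grid_diagonal f : grid f -> dv 1 (f true true - f false false).
Proof.
case=> f0 f1 f2 f3; rewrite (diagonal_difference _ _ (f true false) (f false true)).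
by apply: val_geD => //; apply: val_geD => //; apply: val_geS.
Qed.

Lemma gridM f g : grid f -> grid g -> grid (fun s t => f s t * g s t).
Proof.
move=> gf gg; have g11 := grid_diagonal _ gg; case: gf gg => f0 f1 f2 f3 [g0 g1 g2 g3].
have d0 : forall x, dv 1 x -> dv 0 x by move=> x; apply: val_geS.
have mulB (L : comRingType) (x y z t : L) : x * y - z * t = (x - z) * y + z * (y - t).
  by ring.
have gtf := val_ge_sub _ _ g0 g1; have gft := val_ge_sub _ _ g0 g2.
split.
- exact: val_geMl.
- by rewrite mulB; apply: val_geD; [apply: val_geMr | apply: val_geMl].
- by rewrite mulB; apply: val_geD; [apply: val_geMr | apply: val_geMl].
rewrite second_difference_mul; do !apply: val_geD.
- by apply: val_geMr => //; apply: (val_ge_sub _ _ g0); apply: grid_diagonal.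
- by apply: val_geMl => //; apply: d0.
- exact: (val_geM _ _ 1 1).
- by apply: val_geMl => //; apply: d0.
- exact: (val_geM _ _ 1 1).
- exact: val_geMl.
Qed.

Lemma val_unit_sub x y : un x -> dv 1 (y - x) -> un y.
Proof. by move=> hx hy; rewrite -[y](subrK x) addrC; apply: val_unit_addr. Qed.

Lemma gridV f : grid f -> un (f false false) -> grid (fun s t => (f s t)^-1).
Proof.
move=> gf u00; have f11 := grid_diagonal _ gf; case: gf => f0 f1 f2 f3.
have u10 := val_unit_sub _ _ u00 f1; have u01 := val_unit_sub _ _ u00 f2.
have u11 := val_unit_sub _ _ u00 f11.
have dV x : un x -> dv 0 x^-1 by move=> /val_unitV /val_unit_ge0.
have n00 := val_unit_neq0 _ _ _ u00; have n10 := val_unit_neq0 _ _ _ u10.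
have n01 := val_unit_neq0 _ _ _ u01; have n11 := val_unit_neq0 _ _ _ u11.
have subV (L : fieldType) (x y : L) : x != 0 -> y != 0 -> x^-1 - y^-1 = (x - y) * (- (x^-1 * y^-1)).
  by move=> x0 y0; field; rewrite x0 y0.
split.
- exact: dV.
- rewrite subV //; apply: val_geMr => //; apply/val_geN.
  by apply: val_geMl; apply: dV.
- rewrite subV //; apply: val_geMr => //; apply/val_geN.
  by apply: val_geMl; apply: dV.
rewrite second_difference_inv //; apply: val_geMr; last first.
  by apply: (val_geMl); apply: (val_geMl); apply: dV.
apply: val_geB; last by apply: val_geMr => //; apply: val_geMl; apply: val_unit_ge0.
apply: (val_geM _ _ 1 1) => //; apply: val_geD; apply: val_geMl => //; try exact: val_unit_ge0.
(* The difference along the far edge is not part of [grid]; it is the diagonal difference minus that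
   of the near edge. *)
by rewrite (_ : _ - _ = (f true true - f false false) - (f false true - f false false));
  [apply: val_geB | rewrite opprB addrA subrK].
Qed.

Lemma grid_ext f g : (forall s t, f s t = g s t) -> grid f -> grid g.
Proof. by move=> e [? ? ? ?]; split; rewrite -!e. Qed.

Lemma grid_prod (I : Type) (r : seq I) (f : I -> bool -> bool -> K) :
  (forall i, grid (f i)) -> grid (fun s t => \prod_(i <- r) f i s t).
Proof.
move=> gf; elim: r => [|i r IH].
  apply: (grid_ext (fun _ _ => 1)) => [s t|]; first by rewrite big_nil.
  by apply/grid_cst/val_unit_ge0/val_unit1.
by apply: (grid_ext _ _ _ (gridM _ _ (gf i) IH)) => s t; rewrite big_cons.
Qed.

Lemma gridD f g : grid f -> grid g -> grid (fun s t => f s t + g s t).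
Proof.
move=> [f0 f1 f2 f3] [g0 g1 g2 g3].
have ad (L : comRingType) (x y z t : L) : x + y - (z + t) = (x - z) + (y - t) by ring.
have ad2 (L : comRingType) (x y z t x' y' z' t' : L) :
  (x + x') - (y + y') - (z + z') + (t + t') = (x - y - z + t) + (x' - y' - z' + t').
  by ring.
by split; rewrite ?ad2 ?ad; apply: val_geD.
Qed.

Lemma grid_sum (I : Type) (r : seq I) (f : I -> bool -> bool -> K) :
  (forall i, grid (f i)) -> grid (fun s t => \sum_(i <- r) f i s t).
Proof.
move=> gf; elim: r => [|i r IH].
  by apply: (grid_ext (fun _ _ => 0)) => [s t|]; [rewrite big_nil | apply/grid_cst/val_ge0].
by apply: (grid_ext _ _ _ (gridD _ _ (gf i) IH)) => s t; rewrite big_cons.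
Qed.
End Filtration.

Definition padic (F : fieldType) (P : {poly F}) (P1 : (1 < size P)%N) :
    filtration {fraction {poly F}} :=
  Filtration _ (padic_ge F P) (padic_unit F P) (padic_ge0 F P)
    (padic_geD F P P1) (padic_geN F P) (padic_geM F P) (padic_geS F P)
    (padic_unit1 F P) (padic_unitM F P) (padic_unitV F P)
    (padic_unit_ge0 F P) (padic_unit_neq0 F P P1) (padic_unit_addr F P P1).

(** * Cyclotomic polynomials over a field of characteristic zero *)

Section Cyclotomic.
Variable F : fieldType.
Hypothesis char0 : forall n, (0 < n)%N -> n%:R != 0 :> F.
Local Notation Phi t := (Phi_poly F t).
Local Notation K := {fraction {poly F}}.

Lemma prod_Phi_poly m : (0 < m)%N -> \prod_(e <- divisors m) Phi e = 'X^m - 1.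
Proof.
move=> m0; rewrite -[LHS](rmorph_prod (map_poly (intr : int -> F))) prod_Cyclotomic //.
by rewrite rmorphB rmorph1 /= map_polyXn.
Qed.

Lemma size_Phi_poly t : (0 < t)%N -> (1 < size (Phi t))%N.
Proof.
move=> t0; rewrite /Phi_poly size_map_poly_id0 ?size_Cyclotomic ?ltnS ?totient_gt0 //.
by rewrite (monicP (Cyclotomic_monic t)) oner_eq0.
Qed.

Lemma Phi_poly_dvd e m : (0 < m)%N -> (e %| m)%N -> Phi e %| 'X^m - 1.
Proof.
move=> m0 em; rewrite -prod_Phi_poly // (big_rem e) ?dvdp_mulr //.
by rewrite -dvdn_divisors.
Qed.

Lemma geometric_mod (R : comRingType) (y : R) k :
  exists w, \sum_(i < k) y ^+ i = w * (y - 1) + k%:R.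
Proof.
exists (\sum_(i < k) \sum_(j < i) y ^+ j).
rewrite mulrC mulr_sumr -[k in k%:R]card_ord -sumr_const -big_split /=.
by apply: eq_bigr => i _; rewrite -subrX1 subrK.
Qed.

(** Modulo y - 1 the sum is the constant k, which is invertible in characteristic zero. *)
Lemma coprimep_geometric (y : {poly F}) k : (0 < k)%N ->
  coprimep (y - 1) (\sum_(i < k) y ^+ i).
Proof.
move=> k0; have [w ->] := geometric_mod _ y k.
rewrite coprimep_addl_mul -polyC_natr coprimep_sym -[k%:R]mulr1 polyCM polyC1.
by rewrite mulr1 -alg_polyC coprimepZl ?coprime1p ?char0.
Qed.

(** The cofactor of X^g - 1 in X^t - 1 is a geometric sum in X^g, hence coprime to X^g - 1. It is
    also the product of the Phi_e with e dividing t but not g, so Phi_t divides it. *)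
Lemma coprimep_Phi_proper g t : (0 < g)%N -> (g < t)%N -> (g %| t)%N ->
  coprimep ('X^g - 1) (Phi t).
Proof.
move=> g0 gt gdt; have t0 : (0 < t)%N by apply: leq_trans gt.
have nz : 'X^g - 1 != 0 :> {poly F} by rewrite -size_poly_eq0 size_XnsubC.
apply: (@coprimep_dvdl _ (\sum_(i < t %/ g) 'X^g ^+ i)); last first.
  by apply: coprimep_geometric; rewrite divn_gt0 // ltnW.
have e : ('X^g - 1) * (\sum_(i < t %/ g) 'X^g ^+ i) = 'X^t - 1 :> {poly F}.
  by rewrite -subrX1 -exprM mulnC divnK.
have e2 : ('X^g - 1) * \prod_(e <- divisors t | ~~ (e %| g)%N) Phi e = 'X^t - 1.
  rewrite -(prod_Phi_poly _ t0) [RHS](bigID (fun e => (e %| g)%N)) /= -prod_Phi_poly //.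
  congr (_ * _); rewrite -[RHS]big_filter; apply: perm_big.
  apply: uniq_perm; rewrite ?filter_uniq ?divisors_uniq // => x.
  rewrite mem_filter -!dvdn_divisors //; case: (boolP (x %| g)%N) => //= xg.
  by rewrite (dvdn_trans xg).
rewrite -(mulfI nz (etrans e2 (esym e))) -big_filter (big_rem t) /= ?dvdp_mulr //.
rewrite mem_filter -dvdn_divisors // dvdnn andbT.
by apply/negP => /(dvdn_leq g0); rewrite leqNgt gt.
Qed.

(** Bezout reduces s to the proper divisor g = gcd(s, t) of t: if u s = v t + g, then X^(us) - 1 =
    X^g (X^(vt) - 1) + (X^g - 1), and Phi_t divides X^(vt) - 1. *)
Lemma coprimep_Phi s t : (0 < t)%N -> ~~ (t %| s)%N -> coprimep ('X^s - 1) (Phi t).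
Proof.
move=> t0 ts; have s0 : (0 < s)%N by case: s ts => //; rewrite dvdn0.
case: (egcdnP t s0) => km kn def _.
have g0 : (0 < gcdn s t)%N by rewrite gcdn_gt0 s0.
have gt : (gcdn s t < t)%N.
  rewrite ltn_neqAle dvdn_leq ?dvdn_gcdr // andbT.
  by apply: contra ts => /eqP <-; apply: dvdn_gcdl.
apply: (@coprimep_dvdr _ ('X^(km * s) - 1)); first by rewrite mulnC exprM [X in _ %| X]subrX1 dvdp_mulr.
have /dvdpP[w e] : Phi t %| 'X^(kn * t) - 1.
  by apply: (dvdp_trans (Phi_poly_dvd _ _ t0 (dvdnn t)));
    rewrite mulnC exprM [X in _ %| X]subrX1 dvdp_mulr.
rewrite def exprD (_ : _ - _ = ('X^(gcdn s t) * w) * Phi t + ('X^(gcdn s t) - 1)).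
  by rewrite coprimep_sym coprimep_addl_mul coprimep_sym coprimep_Phi_proper ?dvdn_gcdr.
by rewrite -mulrA -e mulrBr mulr1 mulrC addrA subrK.
Qed.

Section Local.
Variable t : nat.
Hypothesis t1 : (1 < t)%N.
Let P := Phi t.
Let t0 : (0 < t)%N := ltnW t1.
Let sP : (1 < size P)%N := size_Phi_poly _ t0.
Local Notation q := (tofrac 'X : K).

Lemma padic_unit_q : padic_unit F P q.
Proof.
apply: padic_unit_poly; apply: (coprimep_dvdl (Phi_poly_dvd _ _ t0 (dvdnn t))).
rewrite -(prednK t0) exprSr coprimep_addl_mul coprimep_sym -scaleN1r.
by rewrite coprimepZl ?coprime1p // oppr_eq0 oner_eq0.
Qed.

Lemma padic_unit_qz (s : int) : padic_unit F P (q ^ s).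
Proof.
case: s => m; first by apply/padic_unitX/padic_unit_q.
by apply/padic_unitV/padic_unitX/padic_unit_q.
Qed.

Lemma sub1q m : 1 - q ^+ m = - tofrac ('X^m - 1) :> K.
Proof. by rewrite tofracB tofracXn tofrac1 opprB. Qed.

Lemma sub1qN m : 1 - q ^- m = - (q ^- m * (1 - q ^+ m)) :> K.
Proof.
rewrite mulrBr mulr1 mulVf ?opprB //; apply: (@padic_unit_neq0 F P sP).
by apply/padic_unitX/padic_unit_q.
Qed.

Lemma padic_unitN x : padic_unit F P x -> padic_unit F P (- x).
Proof.
move=> h; rewrite -mulN1r; apply: padic_unitM => //.
have -> : -1 = tofrac (-1) :> K by rewrite tofracN tofrac1.
by apply: padic_unit_poly; rewrite -scaleN1r coprimepZl ?coprime1p // oppr_eq0 oner_eq0.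
Qed.

Lemma padic_unit_sub1q (s : int) : ~~ (t %| `|s|)%N -> padic_unit F P (1 - q ^ s).
Proof.
case: s => m h.
  by rewrite sub1q; apply/padic_unitN/padic_unit_poly/coprimep_Phi.
rewrite sub1qN; apply/padic_unitN/padic_unitM; first by apply/padic_unitV/padic_unitX/padic_unit_q.
by rewrite sub1q; apply/padic_unitN/padic_unit_poly/coprimep_Phi.
Qed.

Lemma padic_ge1_sub1q (s : int) : (t %| `|s|)%N -> padic_ge F P 1 (1 - q ^ s).
Proof.
have dvn m : (t %| m)%N -> padic_ge F P 1 (1 - q ^+ m).
  case: m => [|m] h; first by rewrite expr0 subrr; apply: padic_ge0.
  by rewrite sub1q; apply/padic_geN/padic_ge1_poly/Phi_poly_dvd.
case: s => m h; first exact: dvn.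
rewrite sub1qN; apply/padic_geN/padic_geMl; last exact: dvn.
by apply/padic_unit_ge0/padic_unitV/padic_unitX/padic_unit_q.
Qed.

(** Phi_t divides X^m - 1 exactly once. With m = k t the cofactor w is the product of the other
    Phi_e, e | t, and a geometric sum in X^t of length k, all coprime to Phi_t. *)
Lemma padic_ge0_div_sub1q x m : (0 < m)%N -> (t %| m)%N -> padic_ge F P 1 x ->
  padic_ge F P 0 (x / (1 - q ^+ m)).
Proof.
move=> m0 /dvdnP[k mE] [u [v [cv ->]]].
have k0 : (0 < k)%N by case: k mE => //; rewrite mul0n => mE; rewrite mE in m0.
have [w [cw e]] : exists w, coprimep w P /\ 'X^m - 1 = P * w.
  exists (\prod_(e <- rem t (divisors t)) Phi e * \sum_(i < k) 'X^t ^+ i); split.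
    rewrite coprimepMl; apply/andP; split; last first.
      rewrite coprimep_sym; apply: (coprimep_dvdr (Phi_poly_dvd _ _ t0 (dvdnn t))).
      exact: coprimep_geometric.
    rewrite big_seq; apply: (big_ind (fun p => coprimep p P)) => [|x1 x2 h1 h2|e].
    - exact: coprime1p.
    - by rewrite coprimepMl h1.
    rewrite mem_rem_uniq ?divisors_uniq // inE -dvdn_divisors // => /andP[et edt].
    have e0 : (0 < e)%N by apply: dvdn_gt0 edt.
    apply: (coprimep_dvdr (Phi_poly_dvd _ _ e0 (dvdnn e))).
    by apply: coprimep_Phi_proper; rewrite // ltn_neqAle et dvdn_leq.
  rewrite mulrA -(@big_rem _ _ _ _ _ t predT (fun e => Phi e)) -?dvdn_divisors //=.
  by rewrite prod_Phi_poly // -subrX1 -exprM mulnC -mE.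
rewrite sub1q e invrN mulrN; apply: padic_geN; exists u, (v * w).
rewrite coprimepMl cv cw expr0 mul1r expr1 !tofracM; split=> //.
have P0 : tofrac P != 0 :> K by rewrite tofrac_eq0 -size_poly_eq0 -(subnKC sP).
have simpl (L : fieldType) (p x' y z : L) : p != 0 -> y != 0 -> z != 0 ->
    p * x' / y / (p * z) = x' / (y * z).
  by move=> h1 h2 h3; field; rewrite h1 h2 h3.
exact: (simpl K _ _ _ _ P0 (coprimep_neq0 _ _ sP _ cv) (coprimep_neq0 _ _ sP _ cw)).
Qed.

(** With y = a q^s, 1 - y divides 1 - y^t, and y^t = a^t q^(st) reduces to a^t modulo Phi_t. So 1 -
    y^t is a unit, and its integral factor 1 - y is one too. *)
Lemma padic_unit_sub1aq (a : F) (s : int) : a ^+ t != 1 -> padic_unit F P (1 - tofrac a%:P * q ^ s).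
Proof.
move=> at1; have := padic_unit_q => uq.
have da : padic_ge F P 0 (tofrac a%:P * q ^ s).
  by apply: padic_geMl; [apply: padic_ge_poly | apply/padic_unit_ge0/padic_unit_qz].
have dsum x : padic_ge F P 0 x -> padic_ge F P 0 (\sum_(i < t) x ^+ i).
  move=> dx; apply: (padic_ge_sum _ _ sP) => i _; elim: (nat_of_ord i) => [|m IH].
    by apply/padic_unit_ge0/padic_unit1.
  by rewrite exprS; apply: padic_geMl.
apply: (@padic_unit_factor F P sP _ (\sum_(i < t) (tofrac a%:P * q ^ s) ^+ i)).
- by apply: padic_geB => //; apply/padic_unit_ge0/padic_unit1.
- exact: dsum.
have geometric (R : comRingType) (y : R) : (1 - y) * \sum_(i < t) y ^+ i = 1 - y ^+ t.
  by rewrite -[RHS]opprB subrX1 -mulNr opprB.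
rewrite geometric; set x := tofrac a%:P * _.
have -> : 1 - x ^+ t = (1 - tofrac (a ^+ t)%:P) + tofrac (a ^+ t)%:P * (1 - q ^ (s * t%:Z)).
  rewrite /x exprMn mulrBr mulr1 addrA subrK -tofracXn -polyC_exp; congr (_ - _ * _).
  by rewrite exprnP -exprz_exp.
apply: padic_unit_addr => //.
  rewrite -tofrac1 -tofracB -polyC1 -polyCB; apply: padic_unit_poly.
  rewrite -alg_polyC coprimepZl ?coprime1p // subr_eq0 eq_sym //.
by apply: padic_geMl; [apply: padic_ge_poly | apply: padic_ge1_sub1q; rewrite abszM dvdn_mull].
Qed.
End Local.

(** Nonvanishing is read off at a single place: t = |s| + 1 does not divide s, so 1 - q^s is a unit
    at Phi_t. *)
Lemma sub1qz_neq0 (s : int) : s != 0 -> 1 - (tofrac 'X : K) ^ s != 0.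
Proof.
move=> s0; have t1 : (1 < `|s|.+1)%N by rewrite ltnS absz_gt0.
apply: (padic_unit_neq0 _ _ (size_Phi_poly _ (ltnW t1))); apply: padic_unit_sub1q => //.
by apply/negP => /dvdn_leq; rewrite absz_gt0 s0 ltnn => /(_ isT).
Qed.

Lemma sub1aqz_neq0 (a : F) (s : int) : a ^+ 2 != 1 ->
  1 - tofrac a%:P * (tofrac 'X : K) ^ s != 0.
Proof.
move=> a2; apply: (padic_unit_neq0 _ _ (size_Phi_poly 2 isT)).
exact: padic_unit_sub1aq.
Qed.
End Cyclotomic.

(** * Estimates for the very-well-poised sum *)

Lemma ndvd_mulS (t d i : nat) : coprime t d -> (i.+1 < t)%N ->
  ~~ (t %| `|(d%:Z + d%:Z * i%:Z)%R|)%N.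
Proof.
move=> td it; have -> : `|(d%:Z + d%:Z * i%:Z)%R|%N = (d * i.+1)%N by lia.
by rewrite Gauss_dvdr //; apply/negP => /(dvdn_leq (ltn0Sn i)); rewrite leqNgt it.
Qed.

Section Main.
Variables (K : fieldType) (q a b : K) (d : nat).
Hypotheses (q0 : q != 0) (a0 : a != 0) (b0 : b != 0) (d0 : (0 < d)%N).
Hypothesis two : 1 + 1 != 0 :> K.
Hypothesis sub1q0 : forall s : int, s != 0 -> 1 - q ^ s != 0.
Local Notation Q := (q ^+ d).
Definition avoids x := forall s : int, 1 - x * q ^ s != 0.
Hypotheses (aa : avoids a) (aV : avoids a^-1) (ba : avoids b) (bV : avoids b^-1).

Lemma exprQ_qz s : Q ^+ s = q ^ (d%:Z * s%:Z).
Proof. by rewrite -exprM exprnP PoszM. Qed.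

Lemma qz_exprQ (s : int) i : q ^ s * Q ^+ i = q ^ (s + d%:Z * i%:Z).
Proof. by rewrite exprQ_qz -expfzDr. Qed.

Definition vwpz (eh eA ef er es ez : int) k :=
  vwp K Q a b (q ^ eh) (q ^ eA) (q ^ ef) (q ^ er) (q ^ es) (q ^ ez) k.

(** Here c = q^ec. A factor 1 - Q^(i+1)/c of the denominator could vanish only if ec = d (i + 1),
    which the condition on [ec] excludes. *)
Lemma sum_vwpz_pair N (ec : int) : (ec = 0) \/ ~~ (d %| `|ec|)%N ->
  \sum_(0 <= k < N.+1)
    vwpz (- (d%:Z * N%:Z)) (- (d%:Z * N%:Z)) (ec - d%:Z * N%:Z) d (d%:Z - ec)
      (d%:Z * (3 * N%:Z + 2) - ec) k = 0.
Proof.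
move=> hec.
have dn0 i : d%:Z * i.+1%:Z != 0 by rewrite mulf_neq0 // -lt0n.
have Q0 : Q != 0 by rewrite expf_neq0.
have hQ i : 1 - Q ^+ i.+1 != 0 by rewrite exprQ_qz sub1q0.
have c0 : q ^ ec != 0 by rewrite expfz_neq0.
have avQ x : avoids x -> forall i, 1 - x * Q ^+ i.+1 != 0.
  by move=> h i; rewrite exprQ_qz.
have avc i : 1 - (q ^ ec)^-1 * Q ^+ i.+1 != 0.
  rewrite exprQ_qz invr_expz -expfzDr //; apply: sub1q0.
  case: hec => [->|]; first by rewrite oppr0 add0r.
  apply: contra => /eqP h; have -> : ec = d%:Z * i.+1%:Z by lia.
  by rewrite abszM dvdn_mulr.
rewrite -[RHS](sum_vwp0 K Q Q0 hQ a b (q ^ ec) a0 b0 c0 (avQ _ aa) (avQ _ aV)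
  (avQ _ ba) (avQ _ bV) avc N two).
apply: eq_bigr => k _; rewrite /vwpz !exprQ_qz; congr vwp.
- by rewrite invr_expz.
- by rewrite invr_expz.
- by rewrite expfzDr // invr_expz.
- by rewrite expfzDr // invr_expz.
- by rewrite expfzDr // invr_expz PoszD PoszM.
Qed.

Definition vwp_num (r : int) := [:: a * q ^ r; q ^ r / a; b * q ^ r; q ^ r / b; q ^ r; q ^ r].

Lemma vwpz_split (r ez : int) L k :
  vwpz r r r d d ez (L + k) =
   (qpochs (vwp_num r) Q L / qpochs (vwp_num d) Q L * (q ^ ez) ^+ L)
   * vwpz (r + 2 * d%:Z * L%:Z) (r + d%:Z * L%:Z) (r + d%:Z * L%:Z)
       (d%:Z + d%:Z * L%:Z) (d%:Z + d%:Z * L%:Z) ez k.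
Proof.
rewrite /vwpz /vwp /vwp_num !qpochsE !qpochD -!qz_exprQ.
rewrite -![a * _ * Q ^+ L]mulrA -![b * _ * Q ^+ L]mulrA.
have -> : q ^ r * Q ^+ (2 * (L + k)) = q ^ (r + 2 * d%:Z * L%:Z) * Q ^+ (2 * k).
  by rewrite !qz_exprQ; congr (_ ^ _); lia.
rewrite ![_ * Q ^+ L / _]mulrAC exprD !mulr1 !invfM.
by ring.
Qed.

Section Filtered.
Variables (V : filtration K) (t : nat).
Hypothesis t1 : (1 < t)%N.
Local Notation dv := (val_ge K V).
Local Notation un := (val_unit K V).
Hypothesis uq : un q.
Hypothesis ua : un a.
Hypothesis ub : un b.
Hypothesis un_sub1 : forall s : int, ~~ (t %| `|s|)%N -> un (1 - q ^ s).
Hypothesis dv_sub1 : forall s : int, (t %| `|s|)%N -> dv 1 (1 - q ^ s).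
Hypothesis dv_div : forall x (m : nat), (0 < m)%N -> (t %| m)%N -> dv 1 x -> dv 0 (x / (1 - q ^+ m)).
Definition un_avoids x := forall s : int, un (1 - x * q ^ s).
Hypotheses (uaa : un_avoids a) (uaV : un_avoids a^-1) (uba : un_avoids b) (ubV : un_avoids b^-1).

Lemma un_qz (s : int) : un (q ^ s).
Proof. exact: val_unitXz. Qed.

Lemma un_prod (I : Type) (r : seq I) (p : pred I) (f : I -> K) :
  (forall i, p i -> un (f i)) -> un (\prod_(i <- r | p i) f i).
Proof. by move=> h; apply: big_ind => //; [apply: val_unit1 | apply: val_unitM]. Qed.

Lemma un_qpoch_avoid x (s : int) k : un_avoids x -> un (qpoch (x * q ^ s) Q k).
Proof. by move=> ux; apply: un_prod => i _; rewrite -mulrA qz_exprQ; apply: ux. Qed.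

Lemma un_qpoch_q (s : int) k : (forall i, (i < k)%N -> ~~ (t %| `|(s + d%:Z * i%:Z)%R|)%N) ->
  un (qpoch (q ^ s) Q k).
Proof.
move=> h; rewrite /qpoch big_nat; apply: un_prod => i /= ik.
by rewrite qz_exprQ; apply/un_sub1/h.
Qed.

Lemma un_den (er es : int) k :
  (forall i, (i < k)%N -> ~~ (t %| `|(er + d%:Z * i%:Z)%R|)%N) ->
  (forall i, (i < k)%N -> ~~ (t %| `|(es + d%:Z * i%:Z)%R|)%N) ->
  un (qpochs [:: a * q ^ er; q ^ er / a; b * q ^ er; q ^ er / b; q ^ er; q ^ es] Q k).
Proof.
move=> hr hs; rewrite !qpochsE mulr1 ![q ^ er / _]mulrC.
by do !apply: val_unitM; try apply: un_qpoch_avoid => //; apply: un_qpoch_q.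
Qed.

Lemma dv_1subqz x (s : int) : dv 0 x -> dv 0 (1 - x * q ^ s).
Proof.
move=> dx; apply: val_geB; first by apply/val_unit_ge0/val_unit1.
by apply: val_geMl => //; apply/val_unit_ge0/un_qz.
Qed.

Lemma dv0_qpoch x k : dv 0 x -> dv 0 (qpoch x Q k).
Proof.
move=> dx; rewrite /qpoch; apply: big_ind => [|x' y' h h'|i _].
- by apply/val_unit_ge0/val_unit1.
- exact: val_geMl.
- by rewrite exprQ_qz; apply: dv_1subqz.
Qed.

Lemma dv1_qpoch (s : int) k i : (i < k)%N -> (t %| `|(s + d%:Z * i%:Z)%R|)%N ->
  dv 1 (qpoch (q ^ s) Q k).
Proof.
move=> ik ti; rewrite -(subnKC ik) qpochD qpochS.
have dqz (s' : int) k' : dv 0 (qpoch (q ^ s') Q k') by apply/dv0_qpoch/val_unit_ge0/un_qz.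
apply: val_geMr; last by rewrite qz_exprQ; apply: dqz.
by apply: val_geMl => //; rewrite qz_exprQ; apply: dv_sub1.
Qed.

Local Notation grid := (grid K V).

Lemma grid_qz (e : bool -> bool -> int) :
  (t %| `|(e true false - e false false)%R|)%N -> (t %| `|(e false true - e false false)%R|)%N ->
  e true true = e true false + e false true - e false false ->
  grid (fun s t => q ^ e s t).
Proof.
move=> h1 h2 e3.
set e0 := e false false in h1 h2 e3 *.
have e1 : e true false = e0 + (e true false - e0) by lia.
have e2 : e false true = e0 + (e false true - e0) by lia.
rewrite /grid -/e0 e3.
move: (e true false - e0) h1 e1 => u h1 e1; move: (e false true - e0) h2 e2 => v h2 e2.
have du := dv_sub1 _ h1; have dv' := dv_sub1 _ h2.
have d00 : dv 0 (q ^ e0) by apply/val_unit_ge0/un_qz.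
split; rewrite ?e1 ?e2 /=.
- exact: d00.
- rewrite expfzDr // (_ : _ - _ = - (q ^ e0 * (1 - q ^ u))); last by ring.
  by apply/val_geN/val_geMl.
- rewrite expfzDr // (_ : _ - _ = - (q ^ e0 * (1 - q ^ v))); last by ring.
  by apply/val_geN/val_geMl.
have -> : e0 + u + (e0 + v) - e0 = e0 + u + v by ring.
rewrite !expfzDr // (_ : _ + _ = q ^ e0 * ((1 - q ^ u) * (1 - q ^ v))); last by ring.
by apply: val_geMl => //; apply: (val_geM _ _ 1 1).
Qed.

Lemma grid_qpoch x k : grid x -> grid (fun s t => qpoch (x s t) Q k).
Proof.
move=> gx; apply: (grid_prod K V nat) => i; apply: gridD.
  by apply/grid_cst/val_unit_ge0/val_unit1.
apply: (grid_ext _ _ (fun s t => (-1) * (x s t * Q ^+ i))) => [s t'|]; first by rewrite mulN1r.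
have dQ : dv 0 (Q ^+ i) by rewrite exprQ_qz; apply/val_unit_ge0/un_qz.
apply: gridM; first by apply/grid_cst/val_geN/val_unit_ge0/val_unit1.
by apply: gridM => //; apply: grid_cst.
Qed.

Lemma gridX x k : grid x -> grid (fun s t => x s t ^+ k).
Proof.
move=> gx; elim: k => [|k IH]; first by apply/grid_cst/val_unit_ge0/val_unit1.
by apply: (grid_ext _ _ _ _ _ (gridM _ _ _ _ gx IH)) => s t'; rewrite exprS.
Qed.

Lemma grid_qpochs A f k : grid A -> grid f ->
  grid (fun s t => qpochs [:: a * A s t; A s t / a; b * A s t; A s t / b; A s t; f s t] Q k).
Proof.
move=> gA gf.
have gm x : un x -> grid (fun s t => x * A s t).
  by move=> ux; apply: gridM => //; apply/grid_cst/val_unit_ge0.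
have gd x : un x -> grid (fun s t => A s t / x).
  by move=> ux; apply: gridM => //; apply/grid_cst/val_unit_ge0/val_unitV.
apply: (grid_ext _ _ (fun s t => qpoch (a * A s t) Q k * (qpoch (A s t / a) Q k *
  (qpoch (b * A s t) Q k * (qpoch (A s t / b) Q k * (qpoch (A s t) Q k * qpoch (f s t) Q k)))))).
  by move=> s t'; rewrite !qpochsE mulr1.
by do !apply: gridM; apply: grid_qpoch => //; [apply: gm|apply: gd|apply: gm|apply: gd].
Qed.

Lemma grid_vwpz (eh eA ef er es ez : bool -> bool -> int) k :
  grid (fun s t => q ^ eh s t) -> grid (fun s t => q ^ eA s t) ->
  grid (fun s t => q ^ ef s t) -> grid (fun s t => q ^ er s t) ->
  grid (fun s t => q ^ es s t) -> grid (fun s t => q ^ ez s t) ->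
  (forall i, (i < k)%N -> ~~ (t %| `|(er false false + d%:Z * i%:Z)%R|)%N) ->
  (forall i, (i < k)%N -> ~~ (t %| `|(es false false + d%:Z * i%:Z)%R|)%N) ->
  grid (fun s t => vwpz (eh s t) (eA s t) (ef s t) (er s t) (es s t) (ez s t) k).
Proof.
move=> gh gA gf gr gs gz hr hs; rewrite /vwpz /vwp.
apply: gridM; last exact: gridX.
apply: gridM.
  apply: gridD; first by apply/grid_cst/val_unit_ge0/val_unit1.
  apply: (grid_ext _ _ (fun s t => (-1) * (q ^ eh s t * Q ^+ (2 * k)))) => [s t'|].
    by rewrite mulN1r.
  have dQ : dv 0 (Q ^+ (2 * k)) by rewrite exprQ_qz; apply/val_unit_ge0/un_qz.
  apply: gridM; first by apply/grid_cst/val_geN/val_unit_ge0/val_unit1.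
  by apply: gridM => //; apply: grid_cst.
apply: gridM; first exact: grid_qpochs.
by apply: gridV; [apply: grid_qpochs | apply: un_den].
Qed.

(** * First-order vanishing at every Phi_t *)

Section Blocks.
Variables (r : int) (N : nat).
Hypotheses (td : coprime t d) (Nt : (N < t)%N) (tN : (t %| `|(r + d%:Z * N%:Z)%R|)%N).
Local Notation ez := (2 * d%:Z - 3 * r).
Local Notation c := (vwpz r r r d d ez).

(* Each block of t consecutive factors of either q-shifted factorial has exactly
   one factor vanishing at the place, and to first order only. *)
Lemma dv0_qpoch_ratio L : dv 0 (qpoch (q ^ r) Q (L * t) / qpoch Q Q (L * t)).
Proof.
elim: L => [|L IH]; first by rewrite !qpoch0 divr1; apply/val_unit_ge0/val_unit1.
rewrite mulSnr !qpochD -mulf_div; apply: val_geMl => //.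
have e m : Q * Q ^+ m = q ^ (d%:Z + d%:Z * m%:Z).
  by rewrite -exprS exprQ_qz; congr (_ ^ _); lia.
(* In the denominator the vanishing factor is the last of the block, with exponent d (L + 1) t. *)
have -> : qpoch (Q * Q ^+ (L * t)) Q t
    = qpoch (q ^ (d%:Z + d%:Z * (L * t)%N%:Z)) Q t.-1 * (1 - q ^+ (d * (L.+1 * t))).
  rewrite -[X in qpoch _ _ X = _](prednK (ltnW t1)) qpochS e qz_exprQ; congr (_ * (1 - _)).
  by rewrite exprnP; congr (_ ^ _); have := t1; nia.
rewrite invfM mulrA mulrAC; apply: val_geMr.
  apply: dv_div; rewrite ?muln_gt0 ?d0 ?(ltnW t1) ?dvdn_mull //.
  rewrite qz_exprQ; apply: (dv1_qpoch _ _ N) => //.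
  have [w hw] : exists w : int, r + d%:Z * N%:Z = w * t%:Z.
    by exists ((r + d%:Z * N%:Z) %/ t%:Z)%Z; rewrite divzK.
  have -> : r + d%:Z * (L * t)%N%:Z + d%:Z * N%:Z = (w + d%:Z * L%:Z) * t%:Z.
    by rewrite mulrDl -hw PoszM; ring.
  by rewrite abszM dvdn_mull.
apply/val_unit_ge0/val_unitV/un_qpoch_q => i it.
have -> : `|(d%:Z + d%:Z * (L * t)%N%:Z + d%:Z * i%:Z)%R|%N = (d * i.+1 + (d * L) * t)%N by lia.
rewrite dvdn_addl ?(dvdn_mull _ (dvdnn t)) // Gauss_dvdr //.
apply/negP => /(dvdn_leq (ltn0Sn i)); have := t1; lia.
Qed.

(** Only the two quotients of (q^r;Q) by (Q;Q) have denominators that vanish at the place; those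
    carrying a or b have unit denominators. *)
Lemma dv0_vwpz_prefix L :
  dv 0 (qpochs (vwp_num r) Q (L * t) / qpochs (vwp_num d) Q (L * t) * (q ^ ez) ^+ (L * t)).
Proof.
have dz : dv 0 ((q ^ ez) ^+ (L * t)) by apply/val_geX/val_unit_ge0/un_qz.
apply: val_geMr => //.
have -> (k : nat) : qpochs (vwp_num r) Q k / qpochs (vwp_num d) Q k =
  (qpoch (q ^ r) Q k / qpoch Q Q k) * (qpoch (q ^ r) Q k / qpoch Q Q k) *
  ((qpoch (a * q ^ r) Q k * qpoch (a^-1 * q ^ r) Q k * qpoch (b * q ^ r) Q k * qpoch (b^-1 * q ^ r) Q k)
   / (qpoch (a * q ^ d%:Z) Q k * qpoch (a^-1 * q ^ d%:Z) Q k
      * qpoch (b * q ^ d%:Z) Q k * qpoch (b^-1 * q ^ d%:Z) Q k)).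
  by rewrite /vwp_num !qpochsE !mulr1 ![q ^ _ / _]mulrC !invfM -!exprnP; ring.
apply: val_geMl; first by apply: val_geMl; apply: dv0_qpoch_ratio.
have dm x : un x -> dv 0 (qpoch (x * q ^ r) Q (L * t)).
  by move=> ux; apply: dv0_qpoch; apply: val_geMl; apply: val_unit_ge0 => //; apply: un_qz.
apply: val_geMl.
  by do !apply: val_geMl; apply: dm => //; apply: val_unitV.
by apply/val_unit_ge0/val_unitV; do !apply: val_unitM; apply: un_qpoch_avoid.
Qed.

(** Every exponent changes by a multiple of t, since r = - d N modulo t. The grid calculus is reused
    with exponents depending on the first coordinate only, so that the diagonal difference compares
    the two terms. *)
Lemma dv1_vwpz_shift L k : (k < t)%N ->
  dv 1 (vwpz (r + 2 * d%:Z * (L * t)%N%:Z) (r + d%:Z * (L * t)%N%:Z) (r + d%:Z * (L * t)%N%:Z)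
       (d%:Z + d%:Z * (L * t)%N%:Z) (d%:Z + d%:Z * (L * t)%N%:Z) ez k
    - vwpz (- (d%:Z * N%:Z)) (- (d%:Z * N%:Z)) (0 - d%:Z * N%:Z) d (d%:Z - 0)
      (d%:Z * (3 * N%:Z + 2) - 0) k).
Proof.
move=> kt; pose e (u v : int) (s s' : bool) : int := if s then u else v.
have [w hw] : exists w : int, r + d%:Z * N%:Z = w * t%:Z.
  by exists ((r + d%:Z * N%:Z) %/ t%:Z)%Z; rewrite divzK.
have ge (u v : int) : (exists w, u - v = w * t%:Z) -> grid (fun s s' => q ^ e u v s s').
  move=> [w' e']; apply: grid_qz; rewrite /e /= ?subrr ?dvdn0 //; last by ring.
  by rewrite e' abszM dvdn_mull.
have hden i : (i < k)%N -> ~~ (t %| `|(d%:Z + d%:Z * i%:Z)%R|)%N.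
  by move=> ik; apply: (ndvd_mulS _ _ _ td); lia.
have := grid_vwpz (e (r + 2 * d%:Z * (L * t)%N%:Z) (- (d%:Z * N%:Z)))
  (e (r + d%:Z * (L * t)%N%:Z) (- (d%:Z * N%:Z)))
  (e (r + d%:Z * (L * t)%N%:Z) (0 - d%:Z * N%:Z))
  (e (d%:Z + d%:Z * (L * t)%N%:Z) d) (e (d%:Z + d%:Z * (L * t)%N%:Z) (d%:Z - 0))
  (e ez (d%:Z * (3 * N%:Z + 2) - 0)) k.
move=> H; apply: (grid_diagonal _ _ _ (H _ _ _ _ _ _ _ _)) => //.
- apply: ge; exists (w + 2 * d%:Z * L%:Z); rewrite PoszM; nia.
- apply: ge; exists (w + d%:Z * L%:Z); rewrite PoszM; nia.
- apply: ge; exists (w + d%:Z * L%:Z); rewrite PoszM; nia.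
- apply: ge; exists (d%:Z * L%:Z); rewrite PoszM; nia.
- apply: ge; exists (d%:Z * L%:Z); rewrite PoszM; nia.
- apply: ge; exists (- 3 * w); nia.
- by move=> i ik; rewrite /e subr0; apply: hden.
Qed.

Lemma vwpz_pair_eq0 k : (N < k)%N ->
  vwpz (- (d%:Z * N%:Z)) (- (d%:Z * N%:Z)) (0 - d%:Z * N%:Z) d (d%:Z - 0)
      (d%:Z * (3 * N%:Z + 2) - 0) k = 0.
Proof.
move=> Nk; rewrite /vwpz /vwp !qpochsE.
rewrite (@qpoch_eq0 _ _ (q ^ (- (d%:Z * N%:Z))) k N Nk); first by rewrite !(mul0r, mulr0).
by rewrite qz_exprQ addNr expr0z.
Qed.

(** The model series with A = Q^-N has only zero terms beyond N, so its sum vanishes for any length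
    m > N; this serves both full blocks and the last, incomplete one. *)
Lemma dv1_block L m : (m <= t)%N -> (N < m)%N ->
  dv 1 (\sum_(0 <= k < m) c (L * t + k)).
Proof.
move=> mt Nm; under eq_bigr => k _ do rewrite vwpz_split.
rewrite -mulr_sumr; apply: val_geMl; first exact: dv0_vwpz_prefix.
have s0 : \sum_(0 <= k < m) vwpz (- (d%:Z * N%:Z)) (- (d%:Z * N%:Z)) (0 - d%:Z * N%:Z) d (d%:Z - 0)
      (d%:Z * (3 * N%:Z + 2) - 0) k = 0.
  rewrite (@big_cat_nat _ _ _ N.+1) //= sum_vwpz_pair; last by left.
  by rewrite add0r big_nat big1 // => k /andP[Nk _]; apply: vwpz_pair_eq0.
rewrite -[X in dv 1 X]subr0 -[X in dv 1 (_ - X)]s0 -sumrB big_nat; apply: val_ge_sum => k /= km.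
by apply: dv1_vwpz_shift; apply: leq_trans mt.
Qed.

(** The two values of m match the two upper limits M: M + 1 = n is a whole number of blocks, and the
    other limit leaves an incomplete block ending at the index N of this section. *)
Lemma dv1_sum_vwpz L m : m = 0%N \/ m = N.+1 -> dv 1 (\sum_(0 <= k < L * t + m) c k).
Proof.
have full l : dv 1 (\sum_(0 <= k < l * t) c k).
  elim: l => [|l IH]; first by rewrite big_geq //; apply: val_ge0.
  rewrite (@big_cat_nat _ _ _ (l * t)) ?leq_mul //=; apply: val_geD => //.
  rewrite -{1}[(l * t)%N]add0n big_addn mulSn addnK.
  by under eq_bigr => k _ do rewrite addnC; apply: dv1_block.
case=> ->; first by rewrite addn0.
rewrite (@big_cat_nat _ _ _ (L * t)) ?leq_addr //=; apply: val_geD => //.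
rewrite -{1}[(L * t)%N]add0n big_addn addKn.
by under eq_bigr => k _ do rewrite addnC; apply: dv1_block.
Qed.
End Blocks.

(** * Second-order vanishing at Phi_n *)

Section Top.
Variables (r : int) (N m : nat).
Hypotheses (hr : r = 1 \/ r = -1) (d3 : (3 <= d)%N) (td : coprime t d).
Hypotheses (hm : t%:Z + r = d%:Z * m%:Z) (hN : (N + m)%N = t).
Local Notation ez := (2 * d%:Z - 3 * r).
Local Notation X := (t%:Z * (d%:Z - 1)).

(** Here t stands for n and m = (n + r)/d, so N = n - m is the smaller upper limit M. The vanishing
    factor of (q^r;Q)_k for k > N is 1 - q^X. *)
Lemma exponent_at_top : r + d%:Z * N%:Z = X.
Proof. by have := hm; rewrite -hN; nia. Qed.

Lemma top_exponent_nat : X = (t * d.-1)%N%:Z.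
Proof. by rewrite PoszM; congr (_ * _); have := d3; lia. Qed.

Lemma opp_index_gt0 : (0 < m)%N.
Proof. by have := hm; case: (m) => // h; have := t1; have := hr; lia. Qed.

Lemma opp_index_small : (3 * m <= t.+1)%N.
Proof.
have h : (3 * m <= d * m)%N by rewrite leq_mul2r d3 orbT.
by have := hm; have := hr; lia.
Qed.

Lemma top_index_lt : (N < t)%N.
Proof. by rewrite -hN -{1}[N]addn0 ltn_add2l opp_index_gt0. Qed.

Lemma exponent_neq0 (i : int) : r + d%:Z * i != 0.
Proof.
apply/eqP => h; have : (d %| `|r|)%N.
  by rewrite (_ : r = d%:Z * - i) ?abszM ?dvdn_mulr //; lia.
by move/dvdn_leq; have := hr; have := d3; lia.
Qed.

(* Both factorials vanish from length m on, where d m - r = t, and d >= 3 gives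
   2 m <= N + 1, so j or N - j reaches m. *)
Lemma dv1_qpoch_complement j : (j <= N)%N ->
  dv 1 (qpoch (q ^ (d%:Z - r)) Q j * qpoch (q ^ (d%:Z - r)) Q (N - j)).
Proof.
move=> jN.
have dq k : dv 0 (qpoch (q ^ (d%:Z - r)) Q k) by apply/dv0_qpoch/val_unit_ge0/un_qz.
have hit k : (m <= k)%N -> dv 1 (qpoch (q ^ (d%:Z - r)) Q k).
  move=> mk; apply: (dv1_qpoch _ _ m.-1); first by rewrite prednK ?opp_index_gt0.
  rewrite (_ : m.-1%:Z = m%:Z - 1); last by have := opp_index_gt0; lia.
  rewrite (_ : _ + _ = t%:Z); last by rewrite mulrBr -hm; ring.
  by rewrite dvdnn.
case: (leqP m j) => mj; first by apply: val_geMr => //; apply: hit.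
by apply: val_geMl => //; apply: hit; have := opp_index_small; have := hN; lia.
Qed.

(** Watson is applied with B = aA, C = A/a, D = bA, E = A/b, so A/(BC) = A/(DE) = 1/A. Each summand
    on its right side then contains (A;Q)_(j+N+1), where 1 - q^X gives one Phi_n, and (Q/A;Q)_j
    (Q/A;Q)_(N-j), which gives the other; the remaining factors are integral. *)
Lemma dv2_sum_vwpz_watson :
  dv 2 (\sum_(0 <= k < N.+1)
    vwpz r r (- (d%:Z * N%:Z)) d (d%:Z + X) (2 * d%:Z + 3 * d%:Z * N%:Z - 2 * X) k).
Proof.
set A := q ^ r.
have A0 : A != 0 by rewrite expfz_neq0.
have Q0 : Q != 0 by rewrite expf_neq0.
have hQ i : 1 - Q ^+ i.+1 != 0 by rewrite exprQ_qz sub1q0 // mulf_neq0 // -lt0n.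
have hA i : 1 - A * Q ^+ i != 0 by rewrite qz_exprQ sub1q0 ?exponent_neq0.
have p0 : Q ^- N != 0 by rewrite invr_neq0 ?expf_neq0.
have eB : A / (a * A) = a^-1 by rewrite invfM mulrCA divff // mulr1.
have eC : A / (A / a) = a by rewrite invfM invrK mulrA divff // mul1r.
have eD : A / (b * A) = b^-1 by rewrite invfM mulrCA divff // mulr1.
have eE : A / (A / b) = b by rewrite invfM invrK mulrA divff // mul1r.
have eBC : A / (a * A * (A / a)) = A^-1 by field; rewrite a0 A0.
have eDE : A / (b * A * (A / b)) = A^-1 by field; rewrite b0 A0.
have avQ x : avoids x -> forall i, 1 - x * Q ^+ i.+1 != 0.
  by move=> h i; rewrite exprQ_qz.
have := @watson K Q Q0 hQ A (a * A) (A / a) (b * A) (A / b) N A0.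
rewrite !mulf_neq0 ?invr_neq0 // eB eC eD eE eBC eDE => /(_ isT isT isT isT hA).
move=> /(_ (avQ _ aV) (avQ _ aa) (avQ _ bV) (avQ _ ba)) /= W.
have pE : Q ^- N = q ^ (- (d%:Z * N%:Z)) by rewrite exprQ_qz invr_expz.
have ApQ : A / Q ^- N * Q = q ^ (d%:Z + X).
  rewrite pE invr_expz opprK -expfzDr // -[X in _ * X]expr1 qz_exprQ.
  by congr (_ ^ _); rewrite -exponent_at_top; ring.
rewrite (_ : \sum_(_ <= _ < _) _ = \sum_(0 <= k < N.+1) (1 - A * Q ^+ (2 * k)) *
      (qpoch A Q k * qpoch (a * A) Q k * qpoch (A / a) Q k * qpoch (b * A) Q k *
       qpoch (A / b) Q k * qpoch (Q ^- N) Q k) /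
      (qpoch Q Q k * qpoch (a^-1 * Q) Q k * qpoch (a * Q) Q k *
       qpoch (b^-1 * Q) Q k * qpoch (b * Q) Q k *
       qpoch (A / Q ^- N * Q) Q k) *
      (A ^+ 2 * Q ^+ 2 / (a * A * (A / a) * (b * A) * (A / b) * Q ^- N)) ^+ k); last first.
  apply: eq_bigr => k _.
  have -> : A ^+ 2 * Q ^+ 2 / (a * A * (A / a) * (b * A) * (A / b) * Q ^- N)
      = q ^ (2 * d%:Z + 3 * d%:Z * N%:Z - 2 * X).
    have -> : A ^+ 2 * Q ^+ 2 / (a * A * (A / a) * (b * A) * (A / b) * Q ^- N)
      = A^-1 * A^-1 * Q ^+ 2 * Q ^+ N.
      rewrite !invfM !invrK.
      move: (Q ^+ 2) (Q ^+ N) {hA eB eC eD eE eBC eDE W ApQ} (A) A0 => u v x x0.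
      by field; rewrite a0 b0 x0.
    rewrite /A invr_expz -expfzDr // !qz_exprQ; congr (_ ^ _).
    by rewrite -exponent_at_top; ring.
  rewrite ApQ pE /vwpz /vwp !qpochsE !mulr1 -/A ![q ^ d%:Z / _]mulrC -!exprnP !invfM.
  by ring.
have uA : un A by apply: un_qz.
have uQ : un Q by rewrite (exprnP q d); apply: un_qz.
have uQn k : un (Q ^+ k) by rewrite exprQ_qz; apply: un_qz.
rewrite W big_nat; apply: val_ge_sum => j /= jN.
have AVQ : A^-1 * Q = q ^ (d%:Z - r).
  by rewrite invr_expz -[X in _ * X]expr1 qz_exprQ; congr (_ ^ _); ring.
rewrite AVQ; apply: val_geMr.
  apply: (val_geM _ _ 1 1); last exact: dv1_qpoch_complement.
  apply: (dv1_qpoch _ _ N); first by rewrite ltnS leq_addl.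
  by rewrite exponent_at_top abszM dvdn_mulr.
have dun x : un x -> dv 0 (qpoch x Q j) by move=> ux; apply/dv0_qpoch/val_unit_ge0.
apply: val_geMl.
  do !apply: val_geMl; try apply: dun.
  - by apply/val_geX/val_geN/val_unit_ge0/val_unit1.
  - by apply/val_unit_ge0/val_unitV.
  - by apply/val_geX/val_unit_ge0; do ?[apply: val_unitM | apply: val_unitV | done].
  - exact: val_unitM.
  - by apply: val_unitM => //; apply: val_unitV.
  - exact: val_unitV.
have hu (s' : int) : (forall i, (i < j)%N -> ~~ (t %| `|(s' + d%:Z * i%:Z)%R|)%N) ->
    un (qpoch (q ^ s') Q j).
  exact: un_qpoch_q.
have ndvd (i : nat) : (i < j)%N -> ~~ (t %| d * i.+1)%N.
  move=> ij; rewrite Gauss_dvdr //; apply/negP => /(dvdn_leq (ltn0Sn i)).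
  by have := top_index_lt; lia.
have uq' x k : un_avoids x -> un (qpoch (x * Q) Q k).
  by move=> ux; rewrite (exprnP q d); apply: un_qpoch_avoid.
apply/val_unit_ge0/val_unitV; rewrite ApQ; do !apply: val_unitM; try exact: uq'.
  rewrite (exprnP q d); apply: hu => i /ndvd.
  by have -> : `|(d%:Z + d%:Z * i%:Z)%R|%N = (d * i.+1)%N by lia.
(* A Q / p = q^(d + X) with t | X, so its factors are units for the same reason as those of
   (Q;Q)_j. *)
apply: hu => i /ndvd; apply: contra.
have -> : `|(d%:Z + X + d%:Z * i%:Z)%R|%N = (d * i.+1 + t * d.-1)%N.
  by rewrite top_exponent_nat; lia.
by rewrite dvdn_addl // dvdn_mulr.
Qed.

(* Write q^r = Q^-N x and let A = Q^-N y, f = Q^-N z with y, z in {1, x}. The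
   corners with y = 1 vanish by antisymmetry and Watson handles (x, 1), so the
   second-order mixed difference controls the corner (x, x). *)
Lemma dv2_sum_vwpz : dv 2 (\sum_(0 <= k < N.+1) vwpz r r r d d ez k).
Proof.
pose u (s : bool) : int := if s then X else 0.
pose dN : int := d%:Z * N%:Z.
(* The fifth exponent is that of A Q / f and the last that of Q^2 / (A^2 f), so all four corners are
   well-poised. *)
pose G s s' k := vwpz (- dN + u s) (- dN + u s) (u s' - dN) d (d%:Z + u s - u s')
   (2 * d%:Z + 3 * dN - 2 * u s - u s') k.
(* Needed at the corner A = Q^-N, f = Q^-N x, where c = x in the antisymmetry argument. *)
have nd : ~~ (d %| `|X|)%N.
  rewrite top_exponent_nat absz_nat.
  rewrite Gauss_dvdr 1?coprime_sym //; apply/negP => /dvdn_leq.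
  by have := d3; lia.
have G0 s' : \sum_(0 <= k < N.+1) G false s' k = 0.
  rewrite -[RHS](sum_vwpz_pair N (u s')); last by case: s' => /=; [right | left].
  by apply: eq_bigr => k _; rewrite /G /dN /=; congr vwpz; ring.
have G10 : \sum_(0 <= k < N.+1) G true false k =
  \sum_(0 <= k < N.+1)
    vwpz r r (- (d%:Z * N%:Z)) d (d%:Z + X) (2 * d%:Z + 3 * d%:Z * N%:Z - 2 * X) k.
  by apply: eq_bigr => k _; rewrite /G /dN /= -exponent_at_top; congr vwpz; ring.
have G11 : \sum_(0 <= k < N.+1) G true true k = \sum_(0 <= k < N.+1) vwpz r r r d d ez k.
  by apply: eq_bigr => k _; rewrite /G /dN /= -exponent_at_top; congr vwpz; ring.
have : grid (fun s s' => \sum_(k < N.+1) G s s' k).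
  apply: (grid_sum K V 'I_N.+1 _ (fun k s s' => G s s' k)) => k.
  have tX : (t %| `|X|)%N by rewrite abszM dvdn_mulr.
  have hd i : (i < k)%N -> ~~ (t %| `|(d%:Z + d%:Z * i%:Z)%R|)%N.
    by move=> ik; apply: (ndvd_mulS _ _ _ td); have := top_index_lt; have := ltn_ord k; lia.
  have glin (c0 c1 c2 : int) : grid (fun s s' => q ^ (c0 + c1 * u s + c2 * u s')).
    apply: grid_qz; rewrite /u /=; last by ring.
      have -> : c0 + c1 * X + c2 * 0 - (c0 + c1 * 0 + c2 * 0) = c1 * X by ring.
      by rewrite abszM dvdn_mull.
    have -> : c0 + c1 * 0 + c2 * X - (c0 + c1 * 0 + c2 * 0) = c2 * X by ring.
    by rewrite abszM dvdn_mull.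
  have gq (e : bool -> bool -> int) (c0 c1 c2 : int) :
      (forall s s', e s s' = c0 + c1 * u s + c2 * u s') -> grid (fun s s' => q ^ e s s').
    by move=> h; apply: (grid_ext _ _ _ _ _ (glin c0 c1 c2)) => s s'; rewrite h.
  apply: grid_vwpz => //.
  - by apply: (gq _ (- dN) 1 0) => s s'; ring.
  - by apply: (gq _ (- dN) 1 0) => s s'; ring.
  - by apply: (gq _ (- dN) 0 1) => s s'; ring.
  - by apply: (gq _ d%:Z 0 0) => s s'; ring.
  - by apply: (gq _ d%:Z 1 (-1)) => s s'; ring.
  - by apply: (gq _ (2 * d%:Z + 3 * dN) (-2) (-1)) => s s'; ring.
  - by move=> i ik; rewrite /u addr0 subr0; apply: hd.
case=> _ _ _; rewrite -!(big_mkord xpredT (G _ _)) !G0 G10 G11 subr0 addr0.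
by move=> h; have := val_geD K V _ _ _ h dv2_sum_vwpz_watson; rewrite subrK.
Qed.

(** Beyond N both copies of (q^r;Q)_k contain 1 - q^X, while the denominators are still units. This
    carries the estimate from the smaller upper limit to M = n - 1. *)
Lemma dv2_vwpz_tail k : (N < k)%N -> (k < t)%N -> dv 2 (vwpz r r r d d ez k).
Proof.
move=> Nk kt; rewrite /vwpz /vwp; apply: val_geMr; last by apply/val_geX/val_unit_ge0/un_qz.
apply: val_geMl; first by rewrite exprQ_qz mulrC; apply: dv_1subqz; apply/val_unit_ge0/un_qz.
have hd i : (i < k)%N -> ~~ (t %| `|(d%:Z + d%:Z * i%:Z)%R|)%N.
  by move=> ik; apply: (ndvd_mulS _ _ _ td); lia.
apply: val_geMr; last by apply/val_unit_ge0/val_unitV/un_den.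
have dq : dv 0 (q ^ r) by apply/val_unit_ge0/un_qz.
have dm x : un x -> dv 0 (x * q ^ r) by move=> ux; apply: val_geMl => //; apply: val_unit_ge0.
have d1 : dv 1 (qpoch (q ^ r) Q k).
  by apply: (dv1_qpoch _ _ N Nk); rewrite exponent_at_top abszM dvdn_mulr.
rewrite !qpochsE mulr1 ![q ^ r / _]mulrC.
do 4 (apply: val_geMl; first by apply: dv0_qpoch; apply: dm => //; apply: val_unitV).
exact: (val_geM _ _ 1 1).
Qed.
End Top.
End Filtered.
End Main.

Lemma qsum_vwpz (K : fieldType) (q a b : K) d (r : int) M : q != 0 ->
  qsum q a b d r M =
  (1 - q)^-1 * \sum_(0 <= k < M.+1) vwpz K q a b d r r r d d (2 * d%:Z - 3 * r) k.
Proof.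
move=> q0; rewrite mulr_sumr; apply: eq_bigr => k _.
rewrite /vwpz /vwp /qint qz_exprQ //.
have -> : 2 * d%:Z * k%:Z + r = r + d%:Z * (2 * k)%N%:Z by lia.
have -> : q ^ ((2 * d%:Z - 3 * r) * k%:Z) = (q ^ (2 * d%:Z - 3 * r)) ^+ k by rewrite -exprz_exp.
by rewrite -!mulrA mulrCA.
Qed.

(** * From local estimates to the congruence *)

Section Reduction.
Variable F : fieldType.
Hypothesis char0 : forall n, (0 < n)%N -> n%:R != 0 :> F.
Local Notation Phi t := (Phi_poly F t).
Local Notation K := {fraction {poly F}}.

(** By cross multiplication the reduced denominator v divides the local one v', hence is coprime to
    P; and P^e, coprime to v', must divide u. *)
Lemma padic_ge_reduced (P : {poly F}) e (u v : {poly F}) : (1 < size P)%N ->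
  v != 0 -> coprimep u v -> padic_ge F P e (tofrac u / tofrac v) ->
  coprimep v P /\ P ^+ e %| u.
Proof.
move=> P1 v0 cuv [u' [v' [cv' /eqP]]].
have v'0 := coprimep_neq0 F P P1 v' cv'.
have v1 : tofrac v != 0 :> K by rewrite tofrac_eq0.
rewrite (eqr_div _ _ v1 v'0) -!tofracM tofrac_eq => /eqP E.
split.
  apply: coprimep_dvdr cv'; have cvu : coprimep v u by rewrite coprimep_sym.
  by rewrite -(Gauss_dvdpr v' cvu) E dvdp_mull.
have cPv : coprimep (P ^+ e) v' by rewrite coprimep_expl // coprimep_sym.
by rewrite -(Gauss_dvdpl u cPv) E; do ?[exact: dvdp_mulIl | rewrite -mulrA].
Qed.

Lemma exists_reduced (P : {poly F}) e (x : K) : (1 < size P)%N ->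
  padic_ge F P e x -> exists u v : {poly F},
  [/\ v != 0, coprimep u v & x = tofrac u / tofrac v].
Proof.
move=> P1 [u [v [cv ->]]]; have v0 := coprimep_neq0 F P P1 v cv.
rewrite tofrac_eq0 in v0; set w := P ^+ e * u; set g := gcdp w v.
have g0 : g != 0 by rewrite gcdp_eq0 negb_and v0 orbT.
have vE : v %/ g * g = v by rewrite divpK ?dvdp_gcdr.
have v'0 : v %/ g != 0 by apply: contraNneq v0 => h; rewrite -vE h mul0r.
exists (w %/ g), (v %/ g); split=> //.
  by apply: coprimep_div_gcd; rewrite v0 orbT.
have v1 : tofrac v != 0 :> K by rewrite tofrac_eq0.
have v2 : tofrac (v %/ g) != 0 :> K by rewrite tofrac_eq0.
apply/eqP; rewrite (eqr_div _ _ v1 v2) -!tofracM tofrac_eq.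
have wE : w %/ g * g = w by rewrite divpK ?dvdp_gcdl.
apply/eqP; rewrite -[X in X * _ = _]wE -[X in _ = _ * X]vE -mulrA.
by congr (_ * _); rewrite mulrC.
Qed.

Lemma coprimep_Phi_Phi e e' : (0 < e)%N -> (0 < e')%N -> e != e' -> coprimep (Phi e) (Phi e').
Proof.
have aux i j : (0 < i)%N -> (0 < j)%N -> ~~ (j %| i)%N -> coprimep (Phi i) (Phi j).
  move=> i0 j0 ji; apply: coprimep_dvdr (coprimep_Phi _ char0 _ _ j0 ji).
  exact: Phi_poly_dvd.
move=> e0 e'0 ne; case: (boolP (e' %| e)%N) => [h|]; last exact: aux.
rewrite coprimep_sym; apply: aux => //; apply: contra ne => h'.
by rewrite eqn_dvd h h'.
Qed.

Lemma prod_Phi_dvd (s : seq nat) (u : {poly F}) : uniq s ->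
  (forall e, e \in s -> (0 < e)%N /\ Phi e %| u) -> \prod_(e <- s) Phi e %| u.
Proof.
elim: s => [|e s IH] /=; first by rewrite big_nil dvd1p.
move=> /andP[es us] h; rewrite big_cons Gauss_dvdp.
  have [_ ->] := h e (mem_head _ _); apply: IH => // i si.
  by apply: h; rewrite inE si orbT.
have [e0 _] := h e (mem_head _ _).
rewrite big_seq; apply: (big_ind (fun p => coprimep (Phi e) p)) => [|x y hx hy|i si].
- by rewrite coprimep1.
- by rewrite coprimepMr hx.
- apply: coprimep_Phi_Phi => //; first by have [] := h i; rewrite ?inE ?si ?orbT.
  by apply: contraNneq es => ->.
Qed.

Lemma qint_poly_Phi n : (1 < n)%N ->
  qint_poly F n = Phi n * \prod_(e <- rem n (rem 1%N (divisors n))) Phi e.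
Proof.
move=> n1; have n0 : (0 < n)%N by apply: ltnW.
have u := divisors_uniq n.
have in1 : 1%N \in divisors n by rewrite -dvdn_divisors.
have inn : n \in rem 1%N (divisors n).
  by rewrite mem_rem_uniq // inE /= -dvdn_divisors // dvdnn gtn_eqF.
have P1 : Phi 1 = 'X - 1.
  by have := prod_Phi_poly F 1 isT; rewrite (_ : divisors 1 = [:: 1%N]) // big_seq1 expr1.
apply: (mulfI (x := 'X - 1)); first by rewrite polyXsubC_eq0.
rewrite /qint_poly -subrX1 -P1 -prod_Phi_poly //.
rewrite (big_rem 1%N) //=; congr (_ * _).
by rewrite (big_rem n).
Qed.

(** The modulus is Phi_n^2 times the Phi_t with t | n and 1 < t < n, and these factors are pairwise
    coprime. One reduced fraction is fixed first, so that all local estimates bear on the same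
    numerator. *)
Lemma congr_mod_padic n (x : K) : (1 < n)%N ->
  (forall t, (1 < t)%N -> (t %| n)%N -> padic_ge F (Phi t) 1 x) -> padic_ge F (Phi n) 2 x ->
  congr_mod (qint_poly F n * Phi n) x 0.
Proof.
move=> n1 h1 h2; have n0 : (0 < n)%N by apply: ltnW.
have [u [v [v0 cuv xE]]] := exists_reduced _ _ _ (size_Phi_poly F n n0) h2.
rewrite xE in h1 h2.
have [cvn dn] := padic_ge_reduced _ _ _ _ (size_Phi_poly F n n0) v0 cuv h2.
set s := rem n (rem 1%N (divisors n)).
have us : uniq s by rewrite !rem_uniq ?divisors_uniq.
have hs e : e \in s -> [/\ (1 < e)%N, e != n, Phi e %| u & coprimep v (Phi e)].
  rewrite mem_rem_uniq ?rem_uniq ?divisors_uniq // inE.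
  rewrite mem_rem_uniq ?divisors_uniq // inE -dvdn_divisors // => /and3P[en ne1 edn].
  have e1 : (1 < e)%N by rewrite ltn_neqAle eq_sym ne1 (dvdn_gt0 n0 edn).
  have [] := padic_ge_reduced _ _ _ _ (size_Phi_poly F e (ltnW e1)) v0 cuv (h1 e e1 edn).
  by split.
have PE : qint_poly F n * Phi n = Phi n ^+ 2 * \prod_(e <- s) Phi e.
  by rewrite qint_poly_Phi // mulrAC -expr2.
have cop p : (forall e, e \in s -> coprimep p (Phi e)) ->
    coprimep p (\prod_(e <- s) Phi e).
  move=> h; rewrite big_seq; apply: (big_ind (fun y => coprimep p y)) => [|y z hy hz|e].
  - by rewrite coprimep1.
  - by rewrite coprimepMr hy.
  - exact: h.
exists u, v; rewrite subr0 PE; split=> //.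
  rewrite Gauss_dvdp.
    by rewrite dn; apply: prod_Phi_dvd => // e /hs[e1 _ ? _]; split=> //; apply: ltnW.
  rewrite coprimep_expl //; apply: cop.
  by move=> e /hs[e1 en _ _]; apply: coprimep_Phi_Phi; rewrite // 1?eq_sym // ltnW.
rewrite coprimepMr coprimep_expr //=; apply: cop.
by move=> e /hs[].
Qed.
End Reduction.

(** * The congruence over a field of characteristic zero *)

Section Generic.
Variable F : fieldType.
Hypothesis char0 : forall n, (0 < n)%N -> n%:R != 0 :> F.
Local Notation K := {fraction {poly F}}.
Local Notation q := (tofrac 'X : K).
Local Notation C x := (tofrac (x%:P) : K).

Lemma constV x : (C x)^-1 = C x^-1.
Proof.
have [->|x0] := eqVneq x 0; first by rewrite [in RHS]invr0 polyC0 tofrac0 invr0.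
apply: (mulfI (x := C x)); first by rewrite tofrac_eq0 polyC_eq0.
by rewrite divff ?tofrac_eq0 ?polyC_eq0 // -tofracM -polyCM divff // polyC1 tofrac1.
Qed.

Lemma expV_neq1 (x : F) m : x ^+ m != 1 -> x^-1 ^+ m != 1.
Proof. by rewrite exprVn invr_eq1. Qed.

Lemma padic_unit_const P x : x != 0 -> padic_unit F P (C x).
Proof. by move=> x0; apply: padic_unit_poly; rewrite -alg_polyC coprimepZl // coprime1p. Qed.

Lemma fraction_two_neq0 : 1 + 1 != 0 :> K.
Proof.
have -> : 1 + 1 = C 2%:R by rewrite polyC_natr -tofrac1 -tofracD.
by rewrite tofrac_eq0 polyC_eq0 char0.
Qed.

Theorem qsum_congr_mod (a b : F) (r : int) (n d M : nat) :
  a != 0 -> b != 0 ->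
  (forall m, (0 < m)%N -> a ^+ m != 1) -> (forall m, (0 < m)%N -> b ^+ m != 1) ->
  r = 1 \/ r = -1 -> (3 <= d)%N -> (1 < n)%N -> coprime n d ->
  (n%:Z = - r %[mod d%:Z])%Z ->
  M%:Z = ((d%:Z * n%:Z - n%:Z - r) %/ d%:Z)%Z \/ M = (n - 1)%N ->
  congr_mod (qint_poly F n * Phi_poly F n) (qsum q (C a) (C b) d r M) 0.
Proof.
move=> a0 b0 ha hb hr d3 n1 nd nr hM.
have d0 : (0 < d)%N by lia.
have q0 : q != 0 by rewrite tofrac_eq0 polyX_eq0.
have ca0 : C a != 0 by rewrite tofrac_eq0 polyC_eq0.
have cb0 : C b != 0 by rewrite tofrac_eq0 polyC_eq0.
have sub1 := sub1qz_neq0 F char0.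
have av (x : F) : (forall m, (0 < m)%N -> x ^+ m != 1) -> avoids K q (C x).
  by move=> hx s; apply: sub1aqz_neq0; apply: hx.
have hV (x : F) : (forall m, (0 < m)%N -> x ^+ m != 1) -> forall m, (0 < m)%N -> x^-1 ^+ m != 1.
  by move=> hx m m0; apply: expV_neq1; apply: hx.
have avV (x : F) : (forall m, (0 < m)%N -> x ^+ m != 1) -> avoids K q (C x)^-1.
  by move=> hx; rewrite constV; apply/av/hV.
have [m hm] : exists m : nat, n%:Z + r = d%:Z * m%:Z.
  have /dvdzP[w hw] : (d%:Z %| n%:Z + r)%Z.
    by rewrite -[r]opprK -eqz_mod_dvd; apply/eqP.
  by exists `|w|%N; have := hr; nia.
have mn : (m <= n)%N by have := hr; nia.
pose N := (n - m)%N.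
have hN : (N + m)%N = n by rewrite subnK.
have Nn : (N < n)%N.
  by have m0 : (0 < m)%N by [case: (m) hm => // hm0; lia]; lia.
have rN : r + d%:Z * N%:Z = n%:Z * (d%:Z - 1) by nia.
have hM' : M = N \/ M = (n - 1)%N.
  case: hM => h; [left | by right].
  move: h; have -> : d%:Z * n%:Z - n%:Z - r = N%:Z * d%:Z by nia.
  by rewrite mulzK; [case | lia].
rewrite (qsum_vwpz _ _ _ _ _ _ _ q0).
have unit t (t1 : (1 < t)%N) : padic_ge F (Phi_poly F t) 0 (1 - q)^-1.
  apply/padic_unit_ge0/padic_unitV.
  have := padic_unit_sub1q F char0 t t1 1; rewrite expr1z; apply.
  by rewrite dvdn1 gtn_eqF.
have dvdiv t (t1 : (1 < t)%N) := padic_ge0_div_sub1q F char0 t t1.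
have uaq t (t1 : (1 < t)%N) x : (forall m, (0 < m)%N -> x ^+ m != 1) ->
    forall s : int, padic_unit F (Phi_poly F t) (1 - C x * q ^ s).
  by move=> hx s; apply: padic_unit_sub1aq => //; apply/hx/ltnW.
have uaqV t (t1 : (1 < t)%N) x : (forall m, (0 < m)%N -> x ^+ m != 1) ->
    forall s : int, padic_unit F (Phi_poly F t) (1 - (C x)^-1 * q ^ s).
  by move=> hx s; rewrite constV; apply: uaq => //; apply: hV.
apply: (congr_mod_padic F char0 n _ n1) => [t t1 tn|].
  apply: padic_geMl; first exact: unit.
  pose V := padic F (Phi_poly F t) (size_Phi_poly F t (ltnW t1)).
  have td : coprime t d by apply: coprime_dvdl nd.
  have Nt : (N %% t < t)%N by rewrite ltn_mod ltnW.
  (* The index attached to t is N mod t: r + d N = n (d - 1) is a multiple of t, and reducing N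
     modulo t preserves this. *)
  have tN : (t %| `|(r + d%:Z * (N %% t)%N%:Z)%R|)%N.
    have -> : r + d%:Z * (N %% t)%N%:Z = n%:Z * (d%:Z - 1) - d%:Z * (N %/ t)%N%:Z * t%:Z.
      by rewrite -rN {2}(divn_eq N t) PoszD PoszM; ring.
    have nE : n%:Z = (n %/ t)%N%:Z * t%:Z by rewrite -PoszM divnK.
    have -> : n%:Z * (d%:Z - 1) - d%:Z * (N %/ t)%N%:Z * t%:Z
        = ((n %/ t)%N%:Z * (d%:Z - 1) - d%:Z * (N %/ t)%N%:Z) * t%:Z.
      by rewrite nE; ring.
    by rewrite abszM dvdn_mull.
  have H := dv1_sum_vwpz K q (C a) (C b) d q0 ca0 cb0 d0 fraction_two_neq0 sub1
    (av _ ha) (avV _ ha) (av _ hb) (avV _ hb) V t t1 (padic_unit_q F t t1)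
    (padic_unit_const _ _ a0) (padic_unit_const _ _ b0) (padic_unit_sub1q F char0 t t1)
    (padic_ge1_sub1q F t t1)
    (dvdiv t t1) (uaq t t1 _ ha) (uaqV t t1 _ ha) (uaq t t1 _ hb) (uaqV t t1 _ hb)
    r (N %% t)%N td Nt tN.
  case: hM' => ->.
    rewrite (_ : N.+1 = (N %/ t * t + (N %% t).+1)%N); first by apply: H; right.
    by rewrite addnS -divn_eq.
  rewrite (_ : (n - 1).+1 = (n %/ t * t + 0)%N); first by apply: H; left.
  by rewrite divnK // addn0 subn1 prednK // ltnW.
apply: padic_geMl; first exact: unit.
pose V := padic F (Phi_poly F n) (size_Phi_poly F n (ltnW n1)).
have Htop := dv2_sum_vwpz K q (C a) (C b) d q0 ca0 cb0 d0 fraction_two_neq0 sub1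
    (av _ ha) (avV _ ha) (av _ hb) (avV _ hb) V n n1 (padic_unit_q F n n1)
    (padic_unit_const _ _ a0) (padic_unit_const _ _ b0) (padic_unit_sub1q F char0 n n1)
    (padic_ge1_sub1q F n n1)
    (uaq n n1 _ ha) (uaqV n n1 _ ha) (uaq n n1 _ hb) (uaqV n n1 _ hb)
    r N m hr d3 nd hm hN.
case: hM' => ->; first exact: Htop.
have nE : (n - 1).+1 = n by rewrite subn1 prednK // ltnW.
rewrite nE (@big_cat_nat _ _ _ N.+1 0 n _ _ (leq0n _) Nn) /=.
apply: (val_geD _ V _ _ _ Htop).
rewrite big_nat; apply: (val_ge_sum _ V) => k /andP[Nk kn].
exact: (dv2_vwpz_tail K q (C a) (C b) d q0 ca0 cb0 d0 fraction_two_neq0 V n n1 (padic_unit_q F n n1)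
    (padic_unit_const _ _ a0) (padic_unit_const _ _ b0) (padic_unit_sub1q F char0 n n1)
    (padic_ge1_sub1q F n n1)
    (uaq n n1 _ ha) (uaqV n n1 _ ha) (uaq n n1 _ hb) (uaqV n n1 _ hb)
    r N m hr d3 nd hm hN).
Qed.
End Generic.

(** * Specialisation to the indeterminates a and b *)

Lemma Qab_natr_neq0 n : (0 < n)%N -> n%:R != 0 :> Qab.
Proof.
move=> n0; have -> : n%:R = tofrac ((n%:R : rat)%:MP_[2]) by rewrite mpolyC_nat rmorph_nat.
by rewrite tofrac_eq0 mpolyC_eq0 pnatr_eq0 -lt0n.
Qed.

Lemma indeterminate_exp_neq1 (i : 'I_2) m : (0 < m)%N ->
  (tofrac 'X_i : Qab) ^+ m != 1.
Proof.
move=> m0; rewrite -tofracXn -tofrac1 tofrac_eq; apply/negP => /eqP e.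
(* Evaluating the indeterminates at 2 would give 2^m = 1 in the rationals. *)
have := congr1 (fun p => meval (fun _ => 2%:R : rat) p) e.
rewrite rmorphXn /= mevalXU rmorph1 => /eqP.
by rewrite pexpr_eq1 ?ler0n.
Qed.

Lemma indeterminate_neq0 (i : 'I_2) : (tofrac 'X_i : Qab) != 0.
Proof.
rewrite tofrac_eq0; apply/negP => /eqP e.
have := congr1 (fun p => meval (fun _ => 2%:R : rat) p) e.
by rewrite mevalXU rmorph0.
Qed.

Theorem theorem2p3 (r : int) (n d M : nat)
    (hr : r = 1 \/ r = -1) (hd : (3 <= d)%N) (hn : (1 < n)%N)
    (hnd : gcdn n d = 1%N)
    (hmod : (n%:Z = - r %[mod d%:Z])%Z)
    (hM : M%:Z = ((d%:Z * n%:Z - n%:Z - r) %/ d%:Z)%Z \/ M = (n - 1)%N) :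
  congr_mod (qint_poly Qab n * Phi_poly Qab n) (qsum vq va vb d r M) 0.
Proof.
apply: (qsum_congr_mod Qab Qab_natr_neq0 ind_a ind_b r n d M) => //.
- exact: indeterminate_neq0.
- exact: indeterminate_neq0.
- by move=> m; apply: indeterminate_exp_neq1.
- by move=> m; apply: indeterminate_exp_neq1.
- exact/eqP.
Qed.
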